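(* Let $q$ be a prime power. \begin{enumerate} \item For each $x\in\{q,q+1,q+2,2q,2q+1\}$, with the exception of $x=2$ when $q=2$, there exist in $\mathrm{PG}(1,q^3)$ a maximum scattered linear set and a club which meet in exactly $x$ points. \item In $\mathrm{PG}(1,q^3)$ there exist a maximum scattered linear set and a club which meet in exactly $1$ point if and only if $q$ is odd (in which case the point of intersection is not the head of the club). \end{enumerate}
   Context: Field reduction: the points of $\mathrm{PG}(1,q^3)$ are the $1$-dimensional $\mathbb{F}_{q^3}$-subspaces of $\mathbb{F}_{q^3}^2$. Viewing $\mathbb{F}_{q^3}^2$ as a $6$-dimensional $\mathbb{F}_q$-space, they become the planes of a regular (Desarguesian) $2$-spread $\mathcal{S}$ of $\mathrm{PG}(5,q)$. For a plane $\pi$ of $\mathrm{PG}(5,q)$, $B(\pi)$ denotes the set of points $X$ of $\mathrm{PG}(1,q^3)$ whose corresponding spread plane meets $\pi$. Let $\pi$ be a plane of $\mathrm{PG}(5,q)$ not in $\mathcal{S}$. If $\pi$ meets a unique spread plane $\alpha$ in a line (and so meets $q^2$ further spread planes in a point), then $B(\pi)$ has size $q^2+1$ and is called a club; the point of the club corresponding to $\alpha$ is called its head (the head is uniquely determined by the club). If $\pi$ meets $q^2+q+1$ planes of $\mathcal{S}$, then $B(\pi)$ has size $q^2+q+1$ and is called a maximum scattered linear set. *)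

(* Defs.v *)
From HB Require Import structures.
From mathcomp Require Import all_boot all_order all_algebra all_field.

Set Implicit Arguments.
Unset Strict Implicit.
Unset Printing Implicit Defensive.

Import GRing.Theory.
Local Open Scope ring_scope.

HB.instance Definition _ (K : finFieldType) (vT : vectType K) :=
  Choice_isCountable.Build {vspace vT}
    (pcan_pickleK (can_pcan (@VectorInternalTheory.vs2mxK K vT))).
HB.instance Definition _ (K : finFieldType) (vT : vectType K) :=
  isFinite.Build {vspace vT}
    (pcan_enumP (can_pcan (@VectorInternalTheory.vs2mxK K vT))).

Section FieldReduction.

Variables (F : finFieldType) (L : fieldExtType F).

(* [vecL] and [vecF] have the same elements, the pairs of elements of L:
   [vecL] is L^2 as an L-space, [vecF] is L^2 as an F-space (of dimension 6
   when [L : F] = 3). The points of PG(1, L) are the 1-dimensional subspaces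
   of [vecL]. The alias [finvect_type] only makes L a finite type. *)
Definition vecL : vectType (finvect_type L) :=
  ((finvect_type L)^o * (finvect_type L)^o)%type.
Definition vecF : vectType F := (finvect_type L * finvect_type L)%type.

Definition point := {X : {vspace vecL} | \dim X == 1%N}.

(* The set of vectors of X is already an F-subspace, so that the span does not
   add anything: see [mem_field_reduction]. *)
Definition field_reduction (X : point) : {vspace vecF} :=
  <<[seq v : vecF <- enum (finvect_type vecF) | (v : vecL) \in val X]>>%VS.

Lemma mem_field_reduction (X : point) (v : vecF) :
  (v \in field_reduction X) = ((v : vecL) \in val X).
Proof.
apply/idP/idP; last first.
  move=> Xv; apply: memv_span; rewrite mem_filter Xv /=.
  by rewrite (@mem_enum (finvect_type vecF)).
have scaleFL (a : F) (w : vecF) :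
    a *: w = (a%:A : finvect_type L) *: (w : vecL) :> vecL.
  by case: w => x y; congr pair; rewrite /= -[LHS]mulr_algl.
move=> /(@coord_span _ _ _ (in_tuple _)) ->.
apply: (@big_ind vecF (fun w : vecF => (w : vecL) \in val X)).
- exact: (mem0v (val X)).
- by move=> u w; apply: (@memvD _ _ (val X) (u : vecL) (w : vecL)).
- move=> i _; rewrite scaleFL; apply: (@memvZ _ _ (val X)).
  have := mem_nth (0 : vecF) (ltn_ord i).
  by rewrite mem_filter => /andP[].
Qed.

(* Dimensions are vector-space dimensions: a plane (resp. a line) of
   PG(5, q) is a subspace with \dim = 3 (resp. 2), and two subspaces meet
   when their intersection is not 0. *)
Definition spread : {set {vspace vecF}} := [set field_reduction X | X : point].

Definition linear_set (pi : {vspace vecF}) : {set point} :=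
  [set X | (field_reduction X :&: pi)%VS != 0%VS].

Definition max_scattered (S : {set point}) : Prop :=
  exists pi : {vspace vecF},
    [/\ \dim pi = 3%N, pi \notin spread,
        #|[set alpha in spread | (alpha :&: pi)%VS != 0%VS]|
          = (#|F| ^ 2 + #|F| + 1)%N
      & S = linear_set pi].

Definition club_with_head (C : {set point}) (H : point) : Prop :=
  exists pi : {vspace vecF},
    [/\ \dim pi = 3%N, pi \notin spread,
        forall alpha, alpha \in spread ->
          \dim (alpha :&: pi)%VS = 2%N <-> alpha = field_reduction H
      & C = linear_set pi].

Definition club (C : {set point}) : Prop := exists H, club_with_head C H.

End FieldReduction.

(* Main.v *)
From HB Require Import structures.
Require Import Defs.
From mathcomp Require Import all_boot all_order all_algebra all_field.
From mathcomp Require Import ring zify.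

Set Implicit Arguments.
Unset Strict Implicit.
Unset Printing Implicit Defensive.

Import GRing.Theory.

(** Write [q] for the order of [F], [N] and [Tr] for the norm and trace of the
    cubic extension [L / F], and [<v>] for the point spanned by [v] in [L^2].

    Both kinds of linear sets have a normal form. A maximum scattered linear
    set is [{<x e + x^q e'> : x <> 0}] for some [L]-basis [e], [e'] of [L^2]
    ([max_scattered_param_exists]), so by Hilbert's theorem 90 its points are
    the [<a e + b e'>] with [N a = N b <> 0]. A club with head [<h>] is
    [{<w h + t p> : Tr w = 0, t in F}] for some [L]-basis [h], [p]
    ([club_param_exists]). Conversely every basis gives a linear set of the
    required kind ([exists_max_scattered], [exists_club]).

    Head in S. Choose the coordinates such that [h = e + e'], and use [h] as the
    point at infinity of the line. The other points of [S] are then the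
    [y = x / (x^q - x)], [x] not in [F]. They form a hyperbolic quadric
    [N (y + 1) = N y] of the affine space [L] over [F], ruled by the [q + 1]
    lines on which [u = x^q - x] is constant up to a factor in [F]. The other
    points of the club form a plane [Tr (g y) = t]. A ruling line with
    [Tr (g / u) <> 0] meets this plane in one point; a ruling line with
    [Tr (g / u) = 0] lies in it or misses it. Up to the factor [N u],
    [Tr (g / u)] is a binary quadratic form in [u], which ranges over the
    [F]-plane [Tr u = 0], and every binary form arises from some [g]. Counting
    the head as well, forms with no zero give [q + 2] common points, forms with
    one zero give [q + 1] or [2 q + 1] according to [t], and forms with two
    zeros give [q] or [2 q] ([exists_plane_section_card]); the value [q]
    requires a third choice of [t], whence the exception for [q = 2]. As the
    form of a nonzero [g] does not vanish identically, some ruling line meets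
    the plane: a head in [S] is never the only common point
    ([head_notin_single_meet]).

    One common point, [q] odd. Let [S] consist of the [z] with [N z = 1] and the
    club of the [z = (1 - w) / (1 + w)] with [Tr w = 0], together with the head
    [z = -1]. Since [N (1 + w) - N (1 - w) = 2 Tr w + 2 N w], the only common
    point is [w = 0] ([exists_single_meet]).

    One common point, [q] even. The head is not in [S]. Choose the coordinates
    such that [p = e + e'] spans a common point, and let [h = a e + c e'], with
    [N a <> N c]. A second common point is a nonzero [w] with [Tr w = 0] and
    [N (1 + a w) = N (1 + c w)]. With [d = c - a] this is the equation of a plane
    cubic through the origin, [Tr (d w) + Q w + n N w = 0], where [n <> 0] and
    [Q] is a quadratic form. On the line [F u] it becomes the quadratic equation
    [Tr (d u) + s Q u + s^2 n N u = 0] in [s], which in characteristic 2 has a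
    nonzero root as soon as exactly one of [Tr (d u)] and [Q u] vanishes. If no
    direction [u] is of this kind, then [Q u] is proportional to the square of
    [Tr (d u)], and solvability in a well-chosen direction is governed by the
    Artin-Schreier class of the discriminant of the polynomial whose roots are
    the conjugates of [d]. That class is trivial because the Galois group is
    cyclic of order 3, an even permutation group, and this yields an explicit
    root ([even_second_solution]). Hence a single common point forces [q] to be
    odd ([single_meet_odd]). *)

(** * Frobenius, trace and norm of a cubic extension of finite fields *)

Section CubicExtension.

Local Open Scope ring_scope.

Variables (F : finFieldType) (L : fieldExtType F).
Hypothesis hL : \dim {:L} = 3%N.
Local Notation q := #|F|.

(** Trace and norm keep their values in [L], and the elements of [F] are
    represented by the fixed points of [fr]: identities between conjugates are
    then plain ring identities in [L]. *)
Definition fr (x : L) : L := x ^+ q.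
Definition tr (x : L) : L := x + fr x + fr (fr x).
Definition nm (x : L) : L := x * fr x * fr (fr x).

Lemma fr1 : fr 1 = 1. Proof. by rewrite /fr expr1n. Qed.
Lemma frM x y : fr (x * y) = fr x * fr y. Proof. by rewrite /fr exprMn. Qed.
Lemma frV x : fr x^-1 = (fr x)^-1. Proof. by rewrite /fr exprVn. Qed.
Lemma frX x n : fr (x ^+ n) = fr x ^+ n. Proof. by rewrite /fr -!exprM mulnC. Qed.

Lemma frD x y : fr (x + y) = fr x + fr y.
Proof.
rewrite /fr exprDn_pchar //; have [p pr_p pcharFp] := finPcharP F.
have /pnatP := pprimeChar_pgroup pcharFp; rewrite cardsT => pF.
apply/pnatP => [|r pr_r rF]; first exact: (ltn_trans _ (finNzRing_gt1 F)).
have F_gt0 : (0 < q)%N by exact: (ltn_trans _ (finNzRing_gt1 F)).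
have /eqP -> := pF F_gt0 r pr_r rF.
by rewrite pchar_lalg.
Qed.

Lemma fr0 : fr 0 = 0.
Proof. by apply: (addrI (fr 0)); rewrite -frD !addr0. Qed.
Lemma frN x : fr (- x) = - fr x.
Proof. by apply: (addrI (fr x)); rewrite -frD !subrr fr0. Qed.
Lemma frB x y : fr (x - y) = fr x - fr y. Proof. by rewrite frD frN. Qed.
Lemma fr_nat n : fr n%:R = n%:R.
Proof. by elim: n => [|n IH]; rewrite ?fr0 // -addn1 natrD frD IH fr1. Qed.

Lemma fr3 x : fr (fr (fr x)) = x.
Proof.
rewrite /fr -!exprM; apply/eqP.
have := Fermat's_little_theorem {:L}%AS x; rewrite memvf hL /= => /esym.
by rewrite !expnS expn0 muln1 mulnA.
Qed.

Definition frE := (frD, frM, frN, frV, fr0, fr1, fr_nat, fr3).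

Lemma fr_inj : injective fr.
Proof. by move=> x y e; rewrite -(fr3 x) e fr3. Qed.

Lemma fr_eq0 x : (fr x == 0) = (x == 0).
Proof. by rewrite -{1}fr0 (inj_eq fr_inj). Qed.

Lemma fr_scalar (k : F) : fr k%:A = k%:A.
Proof. by rewrite /fr exprZn expr1n expf_card. Qed.

Lemma fr_fixed x : fr x = x -> exists k : F, x = k%:A.
Proof.
move=> e; apply/vlineP; rewrite (_ : <[_]>%VS = 1%AS :> {vspace L}) //.
by rewrite Fermat's_little_theorem dimv1 expn1; apply/eqP.
Qed.

Lemma fr_tr x : fr (tr x) = tr x.
Proof. by rewrite /tr !frE; ring. Qed.
Lemma fr_nm x : fr (nm x) = nm x.
Proof. by rewrite /nm !frE; ring. Qed.
Lemma trD x y : tr (x + y) = tr x + tr y.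
Proof. by rewrite /tr !frE; ring. Qed.
Lemma trN x : tr (- x) = - tr x.
Proof. by rewrite /tr !frE; ring. Qed.
Lemma trB x y : tr (x - y) = tr x - tr y.
Proof. by rewrite trD trN. Qed.
Lemma trZ k x : fr k = k -> tr (k * x) = k * tr x.
Proof. by move=> e; rewrite /tr !frE e e; ring. Qed.
Lemma nmM x y : nm (x * y) = nm x * nm y.
Proof. by rewrite /nm !frE; ring. Qed.
Lemma nmV x : nm x^-1 = (nm x)^-1.
Proof. by rewrite /nm !frE !invfM. Qed.
Lemma nm_eq0 x : (nm x == 0) = (x == 0).
Proof. by rewrite /nm !mulf_eq0 !fr_eq0 !orbb. Qed.

Lemma card_ext : #|finvect_type L| = (q ^ 3)%N.
Proof.
rewrite -hL -(@card_vspace F (finvect_type L) (Vector.class (finvect_type L))).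
by apply/esym/eq_card => x; rewrite memvf.
Qed.

(** A nonzero polynomial of degree [q ^ 2] cannot vanish at the [q ^ 3]
    elements of [L]. *)
Lemma linearized_neq0 a b c : c != 0 ->
  exists x, a * x + b * fr x + c * fr (fr x) != 0.
Proof.
move=> c0; have q1 : (1 < q)%N := finNzRing_gt1 F.
pose P : {poly L} := a *: 'X + b *: 'X^q + c *: 'X^(q * q).
have szP : size P = (q * q).+1.
  rewrite /P addrC size_polyDl size_scale ?size_polyXn //.
  apply: (leq_ltn_trans (size_polyD _ _)).
  rewrite gtn_max !(leq_ltn_trans (size_scale_leq _ _)) ?size_polyX ?size_polyXn //.
    by rewrite ltnS ltn_Pmull // ltnW.
  by rewrite ltnS; nia.
have P0 : P != 0 by rewrite -size_poly_eq0 szP.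
case: (pickP (fun x : finvect_type L => P.[x] != 0)) => [x Px|P_0].
  by exists x; move: Px; rewrite /P !hornerE /fr -exprM.
have rts : all (root P) (enum (finvect_type L)).
  by apply/allP => x _; rewrite rootE; have /negbFE := P_0 x.
have sz : size (enum (finvect_type L)) = (q ^ 3)%N by rewrite -cardE card_ext.
have := leq_ltn_trans (eq_leq (esym sz)) (max_poly_roots P0 rts (enum_uniq _)).
by rewrite szP; nia.
Qed.

Lemma tr_onto k : fr k = k -> exists x, tr x = k.
Proof.
move=> ek; have [x] := linearized_neq0 1 1 (oner_neq0 L).
rewrite !mul1r -/(tr x) => tx.
exists (k / tr x * x); rewrite trZ ?divfK //.
by rewrite frM frV fr_tr ek.
Qed.

(** Hilbert's theorem 90: [y] is a Lagrange resolvent. *)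
Lemma hilbert90 z : nm z = 1 -> exists2 y, y != 0 & fr y = z * y.
Proof.
move=> nz; have z0 : z != 0 by rewrite -nm_eq0 nz oner_neq0.
have fz0 : fr z != 0 by rewrite fr_eq0.
have [x y0] := linearized_neq0 1 z^-1 (mulf_neq0 (invr_neq0 z0) (invr_neq0 fz0)).
exists (1 * x + z^-1 * fr x + z^-1 / fr z * fr (fr x)) => //.
rewrite !frE; have -> : (fr (fr z))^-1 = z * fr z.
  by apply: (mulfI (_ : fr (fr z) != 0)); rewrite ?fr_eq0 // mulfV ?fr_eq0 // -nz /nm; ring.
by field; rewrite fz0 z0.
Qed.

Lemma nm_eq_ratio u v : v != 0 -> nm u = nm v ->
  exists2 y, y != 0 & fr y * v = u * y.
Proof.
move=> v0 e; have [|y y0 ey] := @hilbert90 (u / v).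
  by rewrite nmM nmV e mulfV // nm_eq0.
by exists y => //; rewrite ey; field.
Qed.

(** Additive form of Hilbert's theorem 90, with the usual explicit solution built
    from an element of trace 1. *)
Lemma additive_hilbert90 (u : L) : tr u = 0 -> exists x, fr x - x = u.
Proof.
move=> tu; have [th tth] := tr_onto fr1.
exists (- (u * fr th + (u + fr u) * fr (fr th))).
have eu : fr (fr u) = - (u + fr u) by apply/eqP; rewrite -addr_eq0 addrC -[X in X == 0]/(tr u) tu.
rewrite frN !frE eu -[RHS]mulr1 -tth /tr; ring.
Qed.

Lemma fr_ratio a b : b != 0 -> fr a * b = a * fr b -> fr (a / b) = a / b.
Proof.
by move=> b0 e; rewrite !frE; apply/eqP; rewrite eqr_div ?fr_eq0 //; apply/eqP.
Qed.

Lemma scalar1_eq0 (k : F) : (k%:A == 0 :> L) = (k == 0).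
Proof. by rewrite scaler_eq0 oner_eq0 orbF. Qed.

Lemma scalar1_inj : injective (fun k : F => k%:A : L).
Proof.
by move=> i j /eqP; rewrite -subr_eq0 -scalerBl scalar1_eq0 subr_eq0 => /eqP.
Qed.

Definition indep3 (b1 b2 b3 : L) : Prop := forall k1 k2 k3,
  fr k1 = k1 -> fr k2 = k2 -> fr k3 = k3 ->
  k1 * b1 + k2 * b2 + k3 * b3 = 0 -> [/\ k1 = 0, k2 = 0 & k3 = 0].

Lemma indep3_span b1 b2 b3 y : indep3 b1 b2 b3 -> exists k1 k2 k3,
  [/\ fr k1 = k1, fr k2 = k2, fr k3 = k3 & y = k1 * b1 + k2 * b2 + k3 * b3].
Proof.
move=> ind.
pose f (k : F * F * F) : finvect_type L := k.1.1%:A * b1 + k.1.2%:A * b2 + k.2%:A * b3.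
have f_inj : injective f.
  move=> [[i j] k] [[i' j'] k']; rewrite /f /= => /eqP; rewrite -subr_eq0 => /eqP e.
  have [||| |e1 e2 e3] := ind (i - i')%:A (j - j')%:A (k - k')%:A; rewrite ?fr_scalar //.
    by rewrite -e !scalerBl; ring.
  by congr (_, _, _); apply/eqP; rewrite -subr_eq0 -scalar1_eq0; apply/eqP.
have [|g _ fK] := inj_card_bij f_inj.
  by rewrite !card_prod card_ext !expnS expn0 muln1 mulnA.
exists (g y).1.1%:A, (g y).1.2%:A, (g y).2%:A; rewrite !fr_scalar.
by split=> //; exact: esym (fK y).
Qed.

Lemma indep3_rot b1 b2 b3 : indep3 b1 b2 b3 -> indep3 b2 b3 b1.
Proof.
move=> ind k1 k2 k3 f1 f2 f3 e.
by have [|? ? ?] := ind k3 k1 k2 f3 f1 f2; first by rewrite -e; ring.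
Qed.

Lemma tr_nondeg g : (forall x, tr (g * x) = 0) -> g = 0.
Proof.
move=> tg; apply/eqP/negP => /negP g0; have [x] := tr_onto fr1.
by rewrite -(mulVKf g0 x) tg => /esym/eqP; rewrite oner_eq0.
Qed.

Lemma indep3_tr_eq0 b1 b2 b3 g : indep3 b1 b2 b3 ->
  tr (g * b1) = 0 -> tr (g * b2) = 0 -> tr (g * b3) = 0 -> g = 0.
Proof.
move=> ind t1 t2 t3; apply: tr_nondeg => x.
have [k1 [k2 [k3 [f1 f2 f3 ->]]]] := indep3_span x ind.
by rewrite !mulrDr !trD !(mulrCA g) (trZ _ f1) (trZ _ f2) (trZ _ f3) t1 t2 t3 !mulr0 !addr0.
Qed.

(** The functional is the cofactor expansion of the determinant of the
    conjugates of [b1], [b2], [b3] along the first row. *)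
Lemma indep3_tr_dual1 b1 b2 b3 : indep3 b1 b2 b3 ->
  exists g, [/\ tr (g * b1) = 1, tr (g * b2) = 0 & tr (g * b3) = 0].
Proof.
move=> ind; pose g := fr b2 * fr (fr b3) - fr (fr b2) * fr b3.
have b30 : b3 != 0.
  apply/eqP => b30; have [||||_ _ /eqP] := ind 0 0 1; rewrite ?frE ?b30 ?oner_eq0 //.
  by ring.
have g0 : g != 0.
  apply/eqP => g0; have f1 := fr_ratio b30 (_ : fr b2 * b3 = b2 * fr b3).
  have [||||_ /eqP] := ind 0 1 (- (b2 / b3)); rewrite ?frN ?fr0 ?fr1 ?oner_eq0 //.
    rewrite f1 //; apply: fr_inj; rewrite !frE; apply/eqP; rewrite -subr_eq0.
    by rewrite -oppr_eq0 opprB; apply/eqP; rewrite -[RHS]g0 /g.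
  by field.
have t2 : tr (g * b2) = 0 by rewrite /tr /g !frE; ring.
have t3 : tr (g * b3) = 0 by rewrite /tr /g !frE; ring.
have t1 : tr (g * b1) != 0.
  by apply/negP => /eqP t1; rewrite (indep3_tr_eq0 ind t1 t2 t3) eqxx in g0.
have ft : fr (tr (g * b1))^-1 = (tr (g * b1))^-1 by rewrite frE fr_tr.
exists ((tr (g * b1))^-1 * g).
by rewrite -!mulrA !(trZ _ ft) t2 t3 !mulr0 mulVf.
Qed.

Lemma indep3_tr_dual b1 b2 b3 k1 k2 k3 : indep3 b1 b2 b3 ->
  fr k1 = k1 -> fr k2 = k2 -> fr k3 = k3 ->
  exists g, [/\ tr (g * b1) = k1, tr (g * b2) = k2 & tr (g * b3) = k3].
Proof.
move=> ind f1 f2 f3; have ind' := indep3_rot ind; have ind'' := indep3_rot ind'.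
have [g1 [t11 t12 t13]] := indep3_tr_dual1 ind.
have [g2 [t22 t23 t21]] := indep3_tr_dual1 ind'.
have [g3 [t33 t31 t32]] := indep3_tr_dual1 ind''.
exists (k1 * g1 + k2 * g2 + k3 * g3).
rewrite !mulrDl !trD -!mulrA !(trZ _ f1) !(trZ _ f2) !(trZ _ f3) t11 t12 t13 t21 t22 t23 t31 t32 t33.
by split; ring.
Qed.

(** [r] and its two conjugates are distinct, so a polynomial of degree 2 over [F]
    that vanishes at [r] has three roots. *)
Lemma indep3_powers r : fr r != r -> indep3 1 r (r ^+ 2).
Proof.
move=> nr c b a fc fb fa e.
have r13 : fr (fr r) != r by apply: contra nr => /eqP {1}<-; rewrite fr3.
have e1 := congr1 fr e; rewrite expr2 !frE fa fb fc in e1.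
have e2 := congr1 fr e1; rewrite !frE fa fb fc in e2.
have h1 : (fr r - r) * (a * (fr r + r) + b) = 0.
  have ec : c = - (b * r + a * r ^+ 2).
    by apply/eqP; rewrite -addr_eq0 -e; apply/eqP; ring.
  by rewrite -[RHS]e1 [in RHS]ec; ring.
have h2 : fr ((fr r - r) * (a * (fr r + r) + b)) = 0 by rewrite h1 fr0.
have sn0 (x y : L) : x != y -> x - y != 0 by rewrite subr_eq0.
move/eqP: h1; rewrite mulf_eq0 (negbTE (sn0 _ _ nr)) /= => /eqP h1.
move/eqP: h2; rewrite fr_eq0 mulf_eq0 (negbTE (sn0 _ _ nr)) /= -fr_eq0 !frE fa fb => /eqP h2.
have : a * (fr (fr r) - r) = 0.
  have eb : b = - (a * (fr r + r)) by apply/eqP; rewrite -addr_eq0 addrC h1.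
  by rewrite -[RHS]h2 [in RHS]eb; ring.
move/eqP; rewrite mulf_eq0 (negbTE (sn0 _ _ r13)) orbF => /eqP a0.
have b0 : b = 0 by rewrite -h1 a0; ring.
by split => //; move: e; rewrite a0 b0 !mul0r !addr0 mulr1.
Qed.

Lemma exists_not_fixed : exists r, fr r != r.
Proof.
have q1 : (1 < q)%N := finNzRing_gt1 F.
have [r] := linearized_neq0 0 (-1) (oner_neq0 L).
rewrite mul0r add0r mulN1r mul1r addrC subr_eq0 => nr.
by exists (fr r).
Qed.

(** The points [1/u], for [u] in an [F]-plane of [L], lie on a conic: no
    three of them are dependent over [F]. *)
Lemma indep3_inv u1 u2 : u1 != 0 -> u2 != 0 -> fr u1 * u2 != u1 * fr u2 ->
  indep3 u1^-1 u2^-1 (u1 + u2)^-1.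
Proof.
move=> u10 u20 nu k1 k2 k3 f1 f2 f3 e.
have nr : fr (u1 / u2) != u1 / u2.
  by rewrite !frE eqr_div ?fr_eq0.
have u120 : u1 + u2 != 0.
  apply: contra nr; rewrite addr_eq0 => /eqP ->; rewrite mulNr mulfV //.
  by rewrite frN fr1.
have [||||h1 h2 h3] := @indep3_powers _ nr k1 (k1 + k2 + k3) k2; rewrite ?frD ?f1 ?f2 ?f3 //.
  have -> : k1 * 1 + (k1 + k2 + k3) * (u1 / u2) + k2 * (u1 / u2) ^+ 2
     = (k1 / u1 + k2 / u2 + k3 / (u1 + u2)) * (u1 * (u1 + u2) / u2).
    by field; rewrite u10 u20 u120.
  by rewrite e mul0r.
by move: h2; rewrite h1 h3 !add0r.
Qed.

(** By the additive form of Hilbert's theorem 90, [x => fr x - x] maps the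
    [F]-plane spanned by [r] and [r ^+ 2] onto the elements of trace 0. *)
Lemma trace0_basis (r : L) (u1 := fr r - r) (u2 := fr (r ^+ 2) - r ^+ 2) :
  fr r != r ->
  [/\ u1 != 0, u2 != 0, fr u1 * u2 != u1 * fr u2, tr u1 = 0 & tr u2 = 0].
Proof.
move=> nr; have u10 : u1 != 0 by rewrite subr_eq0.
have eu : u2 = u1 * (fr r + r) by rewrite /u2 /u1 frX; ring.
have nu : fr u1 * u2 != u1 * fr u2.
  rewrite eu frM frD -subr_eq0.
  have -> : fr u1 * (u1 * (fr r + r)) - u1 * (fr u1 * (fr (fr r) + fr r))
     = fr u1 * u1 * (r - fr (fr r)) by ring.
  rewrite !mulf_neq0 // ?fr_eq0 // subr_eq0.
  by apply: contra nr => /eqP {1}->; rewrite fr3.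
split=> //; last 2 first.
- by rewrite /tr /u1 !frE; ring.
- by rewrite /tr /u2 expr2 !frE; ring.
by apply: contra nu => /eqP ->; rewrite fr0 !mulr0.
Qed.

(** The elements orthogonal to [g] for the trace form are an [F]-plane, which cannot
    contain the three independent inverses of [indep3_inv]. *)
Lemma exists_trace0_inv (g : L) : g != 0 ->
  exists u, [/\ u != 0, tr u = 0 & tr (g / u) != 0].
Proof.
move=> g0; have [r nr] := exists_not_fixed.
have [u10 u20 nu t1 t2] := trace0_basis nr.
move: (fr r - r) (fr (r ^+ 2) - r ^+ 2) u10 u20 nu t1 t2 => u1 u2 u10 u20 nu t1 t2.
have ind := indep3_inv u10 u20 nu.
have u120 : u1 + u2 != 0.
  rewrite addr_eq0; apply: contra nu => /eqP ->; rewrite frN; apply/eqP; ring.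
have [e1|] := eqVneq (tr (g / u1)) 0; last by exists u1.
have [e2|] := eqVneq (tr (g / u2)) 0; last by exists u2.
have [e3|] := eqVneq (tr (g / (u1 + u2))) 0; last first.
  by exists (u1 + u2); split; rewrite // trD t1 t2 addr0.
by rewrite (indep3_tr_eq0 ind e1 e2 e3) eqxx in g0.
Qed.

Lemma nm_1D_eq_trace0 (w : L) : 2%:R != 0 :> L -> tr w = 0 ->
  nm (1 + w) = nm (1 - w) -> w = 0.
Proof.
move=> n2 tw e; apply/eqP; rewrite -nm_eq0 //.
have : 2%:R * nm w = nm (1 + w) - nm (1 - w) - 2%:R * tr w.
  by rewrite /nm /tr !frE; ring.
by rewrite e subrr tw mulr0 subr0 => /eqP; rewrite mulf_eq0 (negbTE n2).
Qed.

(** * A second solution of the norm equation for even [q] *)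

Lemma char2_of_even : ~~ odd q -> 2%:R = 0 :> L.
Proof.
move=> ev; have [p pr_p pcharFp] := finPcharP F.
have /pnatP := pprimeChar_pgroup pcharFp; rewrite cardsT => pF.
have F_gt0 : (0 < q)%N by exact: (ltn_trans _ (finNzRing_gt1 F)).
have : 2%N \in (p : nat_pred) by apply: pF; rewrite // dvdn2.
rewrite inE => /eqP e; have := pcharFp.
by rewrite -(pchar_lalg L) -e inE => /andP[_ /eqP].
Qed.

Lemma char_neq2_of_odd : odd q -> 2%:R != 0 :> L.
Proof.
move=> oq; apply/eqP => c2.
have p2 : 2%N \in [pchar F] by rewrite -(pchar_lalg L) inE /= c2 eqxx.
have := card_pprimeChar p2; rewrite /pPrimeCharType => eq; move: oq; rewrite eq oddX orbF.
move/eqP => e0; have := finNzRing_gt1 F; by rewrite eq e0.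
Qed.

Lemma even_sqrt k : ~~ odd q -> fr k = k -> exists2 s : L, fr s = s & s ^+ 2 = k.
Proof.
move=> ev ek; exists (k ^+ q./2); first by rewrite frX ek.
by rewrite -exprM muln2 halfK (negbTE ev) subn0.
Qed.

Lemma char2_eq (x y z : L) : 2%:R = 0 :> L -> x - y = 2%:R * z -> x = y.
Proof. by move=> c2; rewrite c2 mul0r => /eqP; rewrite subr_eq0 => /eqP. Qed.

(** The second coefficient is [c = a + d], so that [g] is the difference of
    [fr c * fr (fr c)] and [fr a * fr (fr a)]. *)
Section EvenCase.

Variables (a d : L).
Hypothesis c2 : 2%:R = 0 :> L.
Let g := fr a * fr (fr d) + fr (fr a) * fr d + fr d * fr (fr d).
Let n := nm (a + d) - nm a.
Let Q w := tr (g * fr w * fr (fr w)).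

Lemma nm_diff w : nm (1 + (a + d) * w) - nm (1 + a * w) = tr (d * w) + Q w + n * nm w.
Proof. by rewrite /Q /g /n /nm /tr !frE; ring. Qed.

Lemma fr_Q w : fr (Q w) = Q w. Proof. exact: fr_tr. Qed.
Lemma fr_n : fr n = n. Proof. by rewrite /n frB !fr_nm. Qed.

(** Restricting the cubic to the line spanned by [u] and dividing by [s], which
    removes the solution [w = 0]. *)
Lemma scaled_solution u s : u != 0 -> tr u = 0 -> s != 0 -> fr s = s ->
    tr (d * u) + s * Q u + s ^+ 2 * (n * nm u) = 0 ->
  exists w, [/\ w != 0, tr w = 0 & nm (1 + a * w) = nm (1 + (a + d) * w)].
Proof.
move=> u0 tu s0 es e; exists (s * u); rewrite mulf_neq0 // (trZ _ es) tu mulr0.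
split=> //; apply/esym/eqP; rewrite -subr_eq0 nm_diff.
have -> : tr (d * (s * u)) = s * tr (d * u) by rewrite (mulrCA d) (trZ _ es).
have -> : Q (s * u) = s ^+ 2 * Q u by rewrite /Q /tr !frE !es; ring.
have -> : nm (s * u) = s ^+ 3 * nm u by rewrite /nm !frE !es; ring.
by apply/eqP; rewrite -[RHS](mulr0 s) -[in RHS]e; ring.
Qed.

(** The linear term vanishes on all elements of trace 0, so any direction with
    [Q u <> 0] gives a solution; the form [Q] is not zero, since [g = 0] would force
    [a] into [F] and [d = 0]. *)
Lemma even_solution_fixed : d != 0 -> n != 0 -> fr d = d ->
  exists w, [/\ w != 0, tr w = 0 & nm (1 + a * w) = nm (1 + (a + d) * w)].
Proof.
move=> d0 n0 ed; have [g0|g0] := eqVneq g 0.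
  have e : fr a + fr (fr a) + d = 0.
    by apply: (mulfI d0); rewrite mulr0 -[RHS]g0 /g !ed; ring.
  have e' := congr1 fr e; rewrite !frE ed in e'.
  have ea : a = fr a.
    apply/eqP; rewrite -subr_eq0; apply/eqP.
    transitivity ((fr (fr a) + a + d) - (fr a + fr (fr a) + d)); first by ring.
    by rewrite e e' subrr.
  rewrite -!ea in e; case/eqP: d0; rewrite -[RHS]e.
  by apply: (@char2_eq _ _ (- a)) => //; ring.
have [u [u0 tu Qu]] := exists_trace0_inv g0.
have nu0 : nm u != 0 by rewrite nm_eq0.
have eQ : Q u = nm u * tr (g / u).
  by rewrite /Q /tr /nm !frE; field; rewrite u0 !fr_eq0 ?u0.
have Qu0 : Q u != 0 by rewrite eQ mulf_neq0.
apply: (@scaled_solution u (- Q u / (n * nm u))) => //.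
- by apply: mulf_neq0; rewrite ?oppr_eq0 ?invr_eq0 //; apply: mulf_neq0.
- by rewrite frM frN frV frM fr_Q fr_n fr_nm.
- by rewrite (trZ _ ed) tu; field; rewrite nu0 n0.
Qed.

(** Let [h] be the sum of the fractions [d1 / (d1 + d2)], ... in [x]. The second
    elementary symmetric function of [b1], [b2], [b3] equals the sum of the
    [d_i d_j / (d_i + d_j)^2], the discriminant in characteristic 2 of the
    polynomial with roots [d1], [d2], [d3]. It is [h ^+ 2 + h], and [h] is
    invariant under cyclic permutations. *)
Lemma char2_artin_schreier (d1 d2 d3 k : L) :
    d2 + d3 != 0 -> d3 + d1 != 0 -> d1 + d2 != 0 ->
  let N := (d2 + d3) * (d3 + d1) * (d1 + d2) in
  let b1 := d1 * (d2 + d3) ^+ 2 / N in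
  let b2 := d2 * (d3 + d1) ^+ 2 / N in
  let b3 := d3 * (d1 + d2) ^+ 2 / N in
  let x := k + (d1 / (d1 + d2) + d2 / (d2 + d3) + d3 / (d3 + d1)) in
  b1 + b2 + b3 = 1 /\
  (k + b1 + 1) * (k + b2 + 1) * (k + b3 + 1) - (k + b1) * (k + b2) * (k + b3)
    = x ^+ 2 + x.
Proof.
move=> n1 n2 n3 N b1 b2 b3 x.
have N0 : N != 0 by rewrite !mulf_neq0.
have eb : b1 + b2 + b3 = 1.
  apply: (@char2_eq _ _ (2%:R * d1 * d2 * d3 / N)) => //.
  by rewrite /b1 /b2 /b3 /N; field; rewrite n1 n2 n3.
split=> //; pose h1 := d1 / (d1 + d2); pose h2 := d2 / (d2 + d3); pose h3 := d3 / (d3 + d1).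
have e2 : b1 * b2 + b2 * b3 + b3 * b1 = (h1 + h2 + h3) ^+ 2 + (h1 + h2 + h3).
  apply: (@char2_eq _ _ (- (h1 ^+ 2 + h2 ^+ 2 + h3 ^+ 2 + h1 * h2 + h2 * h3 + h3 * h1))) => //.
  by rewrite /b1 /b2 /b3 /h1 /h2 /h3 /N; field; rewrite n1 n2 n3.
rewrite /x -/h1 -/h2 -/h3; move: (h1 + h2 + h3) e2 => h e2.
apply: (@char2_eq _ _ (k ^+ 2 + 2%:R * k - k * h + 1)) => //.
have -> : (k + b1 + 1) * (k + b2 + 1) * (k + b3 + 1) - (k + b1) * (k + b2) * (k + b3)
    = 3%:R * k ^+ 2 + 3%:R * k + 1 + (2%:R * k + 1) * (b1 + b2 + b3)
      + (b1 * b2 + b2 * b3 + b3 * b1) by ring.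
by rewrite eb e2; ring.
Qed.

(** [D] is the direction on which the linear term vanishes. If [Q D <> 0], it gives
    a solution. Otherwise, if the polar form of [Q] is not zero, [Q] has a second
    zero and the equation in that direction is [s ^+ 2 = constant]. Otherwise [Q]
    is proportional to the square of the linear term, which determines [g] from
    [d], then [a] up to a multiple of [d] by an element [k] of [F], and
    [char2_artin_schreier] solves the equation in the direction [d * D]. *)
Lemma even_solution_not_fixed : ~~ odd q -> n != 0 -> fr d != d ->
  exists w, [/\ w != 0, tr w = 0 & nm (1 + a * w) = nm (1 + (a + d) * w)].
Proof.
move=> ev n0 nd.
have d0 : d != 0 by apply: contra nd => /eqP ->; rewrite fr0.
pose D := fr d + fr (fr d).
have D0 : D != 0.
  rewrite /D addr_eq0; apply: contra nd => /eqP e.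
  rewrite -(inj_eq fr_inj) [X in _ == X]e; apply/eqP.
  by apply: (@char2_eq _ _ (fr (fr d))) => //; ring.
have tD : tr D = 0.
  by apply: (@char2_eq _ _ (tr d)) => //; rewrite /tr /D !frE; ring.
have tdD : tr (d * D) = 0.
  apply: (@char2_eq _ _ (d * fr d + fr d * fr (fr d) + fr (fr d) * d)) => //.
  by rewrite /tr /D !frE; ring.
have nD0 : nm D != 0 by rewrite nm_eq0.
have nd0 : nm d != 0 by rewrite nm_eq0.
have tddD : tr (d * (d * D)) = nm D.
  apply: (@char2_eq _ _ (- nm d)) => //.
  by rewrite /nm /tr /D !frE; ring.
have [QD|QD] := eqVneq (Q D) 0; last first.
  apply: (@scaled_solution D (- Q D / (n * nm D))) => //.
  - by apply: mulf_neq0; rewrite ?oppr_eq0 ?invr_eq0 //; apply: mulf_neq0.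
  - by rewrite frM frN frV frM fr_Q fr_n fr_nm.
  - by rewrite tdD; field; rewrite nD0 n0.
(* [nm D * tr g] is the polar form of [Q] at [d * D] and [D]. *)
have polar y : fr y = y -> Q ((d + y) * D) = Q (d * D) + y * (nm D * tr g) + y ^+ 2 * Q D.
  by move=> ey; rewrite /Q /tr /nm /D !frE !ey; ring.
have [tg|tg] := eqVneq (tr g) 0; last first.
  pose y := - Q (d * D) / (nm D * tr g).
  have ey : fr y = y by rewrite /y frM frN frV frM fr_Q fr_nm // fr_tr.
  have Qu : Q ((d + y) * D) = 0.
    by rewrite polar // QD /y; field; rewrite nD0 tg.
  have dy0 : d + y != 0.
    by apply: contra nd; rewrite addr_eq0 => /eqP ->; rewrite frN ey.
  have u0 : (d + y) * D != 0 by apply: mulf_neq0.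
  have nu0 : nm ((d + y) * D) != 0 by rewrite nm_eq0.
  have [s es s2] := @even_sqrt (- nm D / (n * nm ((d + y) * D))) ev
    ltac:(by rewrite frM frN frV frM fr_n !fr_nm).
  apply: (@scaled_solution _ s u0) => //.
  - by rewrite mulrDl trD (trZ _ ey) tdD tD mulr0 addr0.
  - by rewrite -sqrf_eq0 s2; apply: mulf_neq0; rewrite ?oppr_eq0 ?invr_eq0 //; apply: mulf_neq0.
  rewrite Qu mulr0 addr0 s2 (_ : d * ((d + y) * D) = d * (d * D) + y * (d * D)); last by ring.
  by rewrite trD (trZ _ ey) tddD tdD; field; rewrite nu0 n0.
have tgd : tr (g * d ^+ 2) = 0.
  rewrite -[RHS]QD /Q.
  have -> : tr (g * d ^+ 2) = tr (g * d ^+ 2) + (d * fr d + fr d * fr (fr d) + fr (fr d) * d) * tr g.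
    by rewrite tg mulr0 addr0.
  by rewrite expr2 /tr /D !frE; ring.
have tdg : tr (d * g) = nm d.
  apply: (@char2_eq _ _ (nm d + tr (a * fr d * fr (fr d)))) => //.
  by rewrite /tr /nm /g !frE; ring.
(* [g] is orthogonal to [1] and to [d ^+ 2], and so is [D ^+ 2]. *)
pose mu := g / D ^+ 2.
have fmu : fr mu = mu.
  apply: (fr_ratio); first by rewrite expf_neq0.
  apply/eqP; rewrite -subr_eq0; apply/eqP.
  transitivity (tr (g * d ^+ 2) - fr (fr d) ^+ 2 * tr g
    + 2%:R * (fr g * (fr (fr d) ^+ 2 + fr d * fr (fr d)) - g * (d ^+ 2 + d * fr (fr d)))).
    by move: (g) => g'; rewrite !expr2 /tr /D !frE; ring.
  by rewrite tg tgd c2; ring.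
have eg : g = mu * D ^+ 2 by rewrite /mu divfK // expf_neq0.
have tdD2 : tr (d * D ^+ 2) = nm D.
  apply: (@char2_eq _ _ (2%:R * nm d)) => //.
  by rewrite expr2 /tr /nm /D !frE; ring.
have emu : mu = nm d / nm D.
  apply: (mulIf nD0); rewrite divfK // -tdg eg (mulrCA d) (trZ _ fmu) tdD2 //.
clearbody mu; pose b := d * D ^+ 2 / nm D.
pose k := a / d + b.
have fd0 : fr d != 0 by rewrite fr_eq0.
have D2 : fr (fr d) + d != 0 by rewrite -[_ + _](_ : fr D = _) ?fr_eq0 // /D !frE.
have D3 : d + fr d != 0 by rewrite -[_ + _](_ : fr (fr D) = _) ?fr_eq0 // /D !frE.
have enD : nm D = D * (fr (fr d) + d) * (d + fr d) by rewrite /nm {2 3}/D !frE.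
pose e := d / (d + fr d) + fr d / D + fr (fr d) / (fr (fr d) + d).
have fe : fr e = e by rewrite /e /D !frE; ring.
have efb : fr b = fr d * (fr (fr d) + d) ^+ 2 / nm D.
  by rewrite /b expr2 !frM frV fr_nm // /D !frE -expr2.
have effb : fr (fr b) = fr (fr d) * (d + fr d) ^+ 2 / nm D.
  by rewrite efb expr2 !frM frV fr_nm // !frE -expr2.
have [trb eN] := char2_artin_schreier k D0 D2 D3.
rewrite -enD -/b -efb -effb -/e in trb eN.
have ffeg : a * fr d + fr a * d + d * fr d = d * fr d * fr (fr b).
  transitivity (fr (fr g)); first by rewrite /g !frE; ring.
  rewrite eg effb expr2 !frM !fmu emu /nm /D !frE; field.
  by rewrite D3 D2 D0.
(* The conjugates of [a / d + b] agree pairwise by [ffeg] and [trb]. *)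
have fk : fr k = k.
  apply: (@char2_eq _ _ (- b - a / d)) => //.
  have -> : fr k = fr (fr b) - 1 - a / d + fr b.
    rewrite /k frD frM frV; congr (_ + _); apply: (mulIf (mulf_neq0 d0 fd0)).
    have -> : (fr (fr b) - 1 - a / d) * (d * fr d) = d * fr d * fr (fr b) - d * fr d - a * fr d.
      by field.
    by rewrite -ffeg; field.
  have -> : fr (fr b) = (b + fr b + fr (fr b)) - b - fr b by ring.
  by rewrite trb /k; ring.
have ea : a = d * (k + b).
  by apply: (@char2_eq _ _ (- (d * b))) => //; rewrite /k; field.
clearbody k b e; have en : n = nm d * ((k + e) ^+ 2 + (k + e)).
  by rewrite -eN /n ea /nm !frE !fk; ring.
have ke0 : k + e != 0.
  by apply: contra n0 => /eqP ke; rewrite en ke; apply/eqP; ring.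
apply: (@scaled_solution (d * D) (nm d * (k + e))^-1).
- by apply: mulf_neq0.
- by [].
- by rewrite invr_eq0; apply: mulf_neq0.
- by rewrite frV frM frD fr_nm // fk fe.
have QdD : Q (d * D) = nm d * nm D.
  have -> : Q (d * D) = mu * nm D * tr (D * fr d * fr (fr d)).
    rewrite /Q eg /nm; move: fmu; move: (mu) => m fm.
    by rewrite /tr expr2 !frE !fm; ring.
  rewrite emu divfK //; congr (_ * _).
  by apply: (@char2_eq _ _ (- nm d)) => //; rewrite /tr /nm /D !frE; ring.
rewrite tddD QdD en nmM; apply: (@char2_eq _ _ (nm D * (1 + (k + e)^-1))) => //.
by field; rewrite nd0 ke0.
Qed.


End EvenCase.

Lemma even_second_solution (a c : L) : ~~ odd q -> a != c -> nm a != nm c ->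
  exists w, [/\ w != 0, tr w = 0 & nm (1 + a * w) = nm (1 + c * w)].
Proof.
move=> ev ac nac; have c2 := char2_of_even ev.
have ea : a + (c - a) = c by rewrite addrC subrK.
have n0 : nm (a + (c - a)) - nm a != 0 by rewrite ea subr_eq0 eq_sym.
have d0 : c - a != 0 by rewrite subr_eq0 eq_sym.
have [fd|fd] := eqVneq (fr (c - a)) (c - a).
  by have := even_solution_fixed c2 d0 n0 fd; rewrite ea.
by have := even_solution_not_fixed c2 ev n0 fd; rewrite ea.
Qed.

(** * Plane sections of a ruled quadric *)

(** [k => k ^+ 2 + k] takes the value [0] at [0] and [-1], so it is not onto. *)
Lemma exists_irreducible_quadratic : exists c : F, forall k, k ^+ 2 + k + c != 0.
Proof.
pose f (k : F) := - (k ^+ 2 + k).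
have [/forallP onto|/forallPn [c /existsPn nc]] := boolP [forall c, [exists k, f k == c]].
  have fT : f @: setT = setT.
    apply/setP => c; rewrite inE; have /existsP [k /eqP <-] := onto c.
    by rewrite imset_f.
  have /imset_injP finj : #|f @: setT| == #|[set: F]| by rewrite fT.
  have := finj 0 (-1); rewrite !inE /f => /(_ isT isT).
  have -> : - (0 ^+ 2 + 0) = - ((-1) ^+ 2 + -1) :> F by ring.
  by move=> /(_ erefl) /esym /eqP; rewrite oppr_eq0 oner_eq0.
exists c => k; have := nc k; rewrite /f; apply: contra.
by rewrite addrC addr_eq0 eq_sym.
Qed.

(** The values of [quot] outside [F] are the affine points of the hyperbolic quadric
    [nm (y + 1) = nm y]. *)
Definition quot (x : L) := x / (fr x - x).

Lemma quot_eq x y : fr x != x -> fr y != y -> quot x = quot y ->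
  exists2 k, fr k = k & x = k * y.
Proof.
rewrite -(subr_eq0 (fr x)) -(subr_eq0 (fr y)) => nx ny /eqP.
rewrite /quot eqr_div // => /eqP e.
have y0 : y != 0 by apply: contra ny => /eqP ->; rewrite fr0 subr0.
exists (x / y); last by rewrite divfK.
apply: (fr_ratio) => //; apply: (addIr (- (x * y))).
transitivity (y * (fr x - x)); first by ring.
by rewrite -e; ring.
Qed.

Lemma quotZ k x : k != 0 -> fr k = k -> quot (k * x) = quot x.
Proof.
move=> k0 ek; rewrite /quot frM ek -mulrBr invfM mulrACA mulfV // mul1r //.
Qed.

Section Rulings.

Variable r : L.
Hypothesis nr : fr r != r.

(** Up to a nonzero factor in [F], an element outside [F] is [r + s] or
    [r ^+ 2 + k r + s] for unique [s], [k] in [F]. The option [k] indexes a ruling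
    line of the quadric and [s] a point of that line. *)
Definition ruling_rep (k : option F) : L := if k is Some k then r ^+ 2 + k%:A * r else r.
Definition ruling_diff k := fr (ruling_rep k) - ruling_rep k.
Definition point_rep (p : option F * F) : L := ruling_rep p.1 + p.2%:A.

Let indr := indep3_powers nr.

Lemma point_rep_not_fixed p : fr (point_rep p) != point_rep p.
Proof.
apply/eqP => /(fr_fixed) [c]; case: p => [[k|] s]; rewrite /point_rep /= => e.
  have [||||_ _ /eqP] := @indr (s - c)%:A k%:A 1; rewrite ?fr_scalar ?fr1 ?oner_eq0 //.
  by rewrite mulr1 mul1r scalerBl -e; ring.
have [||||_ /eqP] := @indr (s - c)%:A 1 0; rewrite ?fr_scalar ?fr1 ?fr0 ?oner_eq0 //.
by rewrite mulr1 scalerBl -e; ring.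
Qed.

Lemma quot_point_rep p : quot (point_rep p) = (ruling_rep p.1 + p.2%:A) / ruling_diff p.1.
Proof.
rewrite /quot /point_rep frD fr_scalar /ruling_diff; congr (_ / _); ring.
Qed.

Lemma ruling_diff_neq0 k : ruling_diff k != 0.
Proof.
by rewrite subr_eq0; have := point_rep_not_fixed (k, 0); rewrite /point_rep /= scale0r addr0.
Qed.

Lemma quot_point_rep_inj : injective (fun p => quot (point_rep p)).
Proof.
move=> p p' /(quot_eq (point_rep_not_fixed p) (point_rep_not_fixed p')) [c fc].
have scf (k : F) : fr k%:A = k%:A :> L := fr_scalar k.
have diff0 (x y z : L) : x = y -> z = x - y -> z = 0 by move=> -> ->; rewrite subrr.
have sub0 (x y : L) : x - y = 0 -> x = y by move/eqP; rewrite subr_eq0 => /eqP.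
case: p p' => [[k|] s] [[k'|] s']; rewrite /point_rep /= => e.
- have [||||e1 e2 e3] := @indr (s%:A - c * s'%:A) (k%:A - c * k'%:A) (1 - c);
    rewrite ?frB ?frM ?scf ?fc ?fr1 //.
    by apply: (diff0 _ _ _ e); ring.
  move: e1 e2; rewrite -(sub0 _ _ e3) !mul1r => /sub0/scalar1_inj -> /sub0/scalar1_inj -> //.
- have [||||_ _ /eqP] := @indr (s%:A - c * s'%:A) (k%:A - c) 1;
    rewrite ?frB ?frM ?scf ?fc ?fr1 ?oner_eq0 //.
  by apply: (diff0 _ _ _ e); ring.
- have [||||_ e2 e3] := @indr (s%:A - c * s'%:A) (1 - c * k'%:A) (- c);
    rewrite ?frB ?frN ?frM ?scf ?fc ?fr1 //.
    by apply: (diff0 _ _ _ e); ring.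
  by move/eqP: e2; rewrite -[c]opprK e3 oppr0 mul0r subr0 oner_eq0.
- have [||||e1 e2 _] := @indr (s%:A - c * s'%:A) (1 - c) 0;
    rewrite ?frB ?frM ?scf ?fc ?fr1 ?fr0 //.
    by apply: (diff0 _ _ _ e); ring.
  by move: e1; rewrite -(sub0 _ _ e2) mul1r => /sub0/scalar1_inj ->.
Qed.

Lemma quot_point_rep_onto x : fr x != x -> exists p, quot x = quot (point_rep p).
Proof.
have fixV (k : L) : fr k = k -> fr k^-1 = k^-1 by rewrite frV => ->.
move=> nx; have [a [b [c [fa fb fc ex]]]] := indep3_span x indr.
have [c0|c0] := eqVneq c 0.
  have [b0|b0] := eqVneq b 0.
    by case/eqP: nx; rewrite ex b0 c0 !mul0r !addr0 mulr1.
  have [|s es] := @fr_fixed (b^-1 * a); first by rewrite frM fa fixV.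
  exists (None, s); rewrite -(@quotZ b^-1 x) ?invr_eq0 ?fixV //.
  by rewrite /point_rep /= -es ex c0; congr quot; field.
have [|s es] := @fr_fixed (c^-1 * a); first by rewrite frM fa fixV.
have [|k ek] := @fr_fixed (c^-1 * b); first by rewrite frM fb fixV.
exists (Some k, s); rewrite -(@quotZ c^-1 x) ?invr_eq0 ?fixV //.
by rewrite /point_rep /= -es -ek ex; congr quot; field.
Qed.

Let u1 := fr r - r.
Let u2 := fr (r ^+ 2) - r ^+ 2.
Let cof (x y : L) := fr x * fr (fr y).

Lemma ruling_diff_some k : ruling_diff (Some k) = u2 + k%:A * u1.
Proof. by rewrite /ruling_diff /u2 /u1 /= frD (frM k%:A) fr_scalar; ring. Qed.

(** These are the coefficients of the quadratic form [k => nm u * tr (g / u)], for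
    [u = u2 + k u1], as linear forms in [g]. Their independence means that every
    binary quadratic form arises from some [g]. *)
Lemma indep3_cofactors : indep3 (cof u1 u1) (cof u1 u2 + cof u2 u1) (cof u2 u2).
Proof.
have [n1 n2 nu _ _] := trace0_basis nr.
rewrite -/u1 -/u2 in n1 n2 nu.
have n12 : u1 + u2 != 0.
  by have := ruling_diff_neq0 (Some 1); rewrite ruling_diff_some scale1r mul1r addrC.
have n0 (u : L) : u != 0 -> nm u != 0 by rewrite nm_eq0.
move=> k1 k2 k3 f1 f2 f3 e.
have [||||h1 h3 h2] := @indep3_inv _ _ n1 n2 nu
  ((k1 - k2) * nm u1) ((k3 - k2) * nm u2) (k2 * nm (u1 + u2)).
- by rewrite frM frB fr_nm // f1 f2.
- by rewrite frM frB fr_nm // f2 f3.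
- by rewrite frM fr_nm // f2.
- rewrite -[RHS]e /cof /nm frD (frD (fr u1)); field.
  by rewrite n12 n1 n2.
have k20 : k2 = 0 by apply/eqP; move/eqP: h2; rewrite mulf_eq0 (negbTE (n0 _ n12)) orbF.
move/eqP: h1; rewrite k20 subr0 mulf_eq0 (negbTE (n0 _ n1)) orbF => /eqP ->.
by move/eqP: h3; rewrite k20 subr0 mulf_eq0 (negbTE (n0 _ n2)) orbF => /eqP ->.
Qed.

Lemma tr_div u g : u != 0 -> nm u * tr (g / u) = tr (g * cof u u).
Proof.
by move=> u0; rewrite /tr /nm /cof !frE; field; rewrite u0 !fr_eq0 ?u0.
Qed.

Lemma tr_div_eq0 u g : u != 0 -> (tr (g / u) == 0) = (tr (g * cof u u) == 0).
Proof.
by move=> u0; rewrite -tr_div // mulf_eq0 nm_eq0 // (negbTE u0).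
Qed.

Lemma tr_div_ruling_some g k : (tr (g / ruling_diff (Some k)) == 0) =
  (tr (g * cof u2 u2) + k%:A * tr (g * (cof u1 u2 + cof u2 u1))
    + k%:A ^+ 2 * tr (g * cof u1 u1) == 0).
Proof.
rewrite tr_div_eq0 ?ruling_diff_neq0 // ruling_diff_some /tr /cof.
have fk : fr k%:A = k%:A := fr_scalar k.
by rewrite !frE !fk; congr (_ == 0); ring.
Qed.

Lemma tr_div_ruling_none g : (tr (g / ruling_diff None) == 0) = (tr (g * cof u1 u1) == 0).
Proof. by rewrite tr_div_eq0 ?ruling_diff_neq0. Qed.

(** The points of the quadric in the plane [tr (g * y) = t]. *)
Definition plane_section (g t : L) : {set finvect_type L} :=
  [set y : finvect_type L | (tr (g * y) == t) &&
     [exists x : finvect_type L, (fr x != x) && (y == quot x)]].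

Definition ruling_size (g t : L) (k : option F) : nat :=
  if tr (g / ruling_diff k) == 0 then
    if tr (g * (ruling_rep k / ruling_diff k)) == t then q else 0%N
  else 1%N.

Lemma card_plane_section g t : fr t = t -> #|plane_section g t| =
  (\sum_(k : option F) ruling_size g t k)%N.
Proof.
move=> ft.
pose h p : finvect_type L := quot (point_rep p).
have -> : plane_section g t = h @: [set p | tr (g * h p) == t].
  apply/setP => y; rewrite inE; apply/andP/imsetP => [[ty]|[p]].
    case/existsP => x /andP[nx /eqP e]; have [p ep] := quot_point_rep_onto nx.
    by exists p; rewrite ?inE /h -ep -?e.
  rewrite inE => tp ->; split=> //; apply/existsP; exists (point_rep p).
  by rewrite point_rep_not_fixed /h /=.
rewrite card_imset; last exact: quot_point_rep_inj.
rewrite -sum1dep_card.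
rewrite -(pair_big_dep xpredT (fun k s => tr (g * h (k, s)) == t) (fun _ _ => 1%N)) /=.
apply: eq_bigr => k _; rewrite sum1dep_card /ruling_size.
have eh s : tr (g * h (k, s)) = tr (g * (ruling_rep k / ruling_diff k)) + s%:A * tr (g / ruling_diff k).
  rewrite -(trZ _ (fr_scalar s)) -trD // /h quot_point_rep /=.
  by congr tr; field; rewrite ruling_diff_neq0.
set A := tr (g * (ruling_rep k / ruling_diff k)) in eh *; set B := tr (g / ruling_diff k) in eh *.
have [B0|B0] := eqVneq B 0.
  have [At|At] := eqVneq A t.
    by rewrite -cardsT; apply: eq_card => s; rewrite !inE eh B0 mulr0 addr0 At eqxx.
  by apply: eq_card0 => s; rewrite inE eh B0 mulr0 addr0; apply/negbTE.
have [|s es] := @fr_fixed ((t - A) / B).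
  by rewrite frM frV frB ft /A /B !fr_tr.
rewrite -(cards1 s); apply: eq_card => s'; rewrite !inE eh.
apply/eqP/eqP => [et|->].
  by apply: scalar1_inj; rewrite /= -es -et addrC addrA addNr add0r mulfK.
by rewrite -es divfK // addrC subrK.
Qed.

Lemma sum_option (f : option F -> nat) :
  (\sum_k f k = f None + \sum_(k : F) f (Some k))%N.
Proof.
rewrite (bigD1 None) //=; congr addn.
rewrite (reindex_omap (@Some F) id) /=; last by case.
by apply: eq_bigl => k; rewrite eqxx.
Qed.

Lemma exists_section_no_root : exists g t,
  [/\ g != 0, fr t = t & #|plane_section g t| = q.+1].
Proof.
have [c nc] := exists_irreducible_quadratic.
have [||| g [t1 t2 t3]] := @indep3_tr_dual _ _ _ 1 1 c%:A indep3_cofactors;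
  rewrite ?fr1 ?fr_scalar //.
exists g, 0; split; rewrite ?fr0 //.
  by apply/eqP => g0; move/eqP: t1; rewrite g0 mul0r /tr !fr0 !addr0 eq_sym oner_eq0.
rewrite card_plane_section ?fr0 // sum_option /ruling_size.
rewrite tr_div_ruling_none t1 oner_eq0 add1n; congr _.+1.
rewrite -[RHS]sum1_card; apply: eq_bigr => k _.
rewrite tr_div_ruling_some t1 t2 t3 !mulr1.
have -> : c%:A + k%:A + k%:A ^+ 2 = (k ^+ 2 + k + c)%:A :> L.
  by rewrite !scalerDl expr2 -scalerA (mulr_algl k); ring.
by rewrite scalar1_eq0 (negbTE (nc k)).
Qed.

Lemma exists_section_one_root (b : bool) : exists g t,
  [/\ g != 0, fr t = t & #|plane_section g t| = (b * q + q)%N].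
Proof.
have [||| g [t1 t2 t3]] := @indep3_tr_dual _ _ _ 0 0 1 indep3_cofactors;
  rewrite ?fr1 ?fr0 //.
pose t0 := tr (g * (ruling_rep None / ruling_diff None)).
have ft0 : fr t0 = t0 by apply: fr_tr.
have ft : fr (if b then t0 else t0 + 1) = if b then t0 else t0 + 1.
  by case: b => //; rewrite frD ft0 fr1.
exists g, (if b then t0 else t0 + 1); split=> //.
  by apply/eqP => g0; move/eqP: t3; rewrite g0 mul0r /tr !fr0 !addr0 eq_sym oner_eq0.
rewrite card_plane_section // sum_option /ruling_size tr_div_ruling_none t1 eqxx -/t0; congr addn.
  case: (b); rewrite ?eqxx ?mul1n //.
  by rewrite -subr_eq0 opprD addrA subrr add0r oppr_eq0 oner_eq0.
rewrite -[RHS]sum1_card; apply: eq_bigr => k _.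
by rewrite tr_div_ruling_some t1 t2 t3 !mulr0 !addr0 oner_eq0.
Qed.

(** A plane cannot contain two lines of the same ruling, which are skew. *)
Lemma tr_two_rulings_neq g : g != 0 -> tr (g / ruling_diff None) = 0 ->
    tr (g / ruling_diff (Some 0)) = 0 ->
  tr (g * (ruling_rep None / ruling_diff None)) != tr (g * (ruling_rep (Some 0) / ruling_diff (Some 0))).
Proof.
have n1 := ruling_diff_neq0 None; have n2 := ruling_diff_neq0 (Some 0).
move=> g0 t1 t2; apply: contra g0; rewrite -subr_eq0 -trB // -mulrBr => /eqP t3; apply/eqP.
apply: (@indep3_tr_eq0 _ _ _ g _ t1 t2 t3) => k1 k2 k3 f1 f2 f3 e.
have k30 : k3 = 0.
  apply/eqP/negP => /negP k30.
  have [|a ea] := @fr_fixed (k1 / k3); first by rewrite frM frV f1 f3.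
  have [|b eb] := @fr_fixed (- (k2 / k3)); first by rewrite frN frM frV f2 f3.
  suff /quot_point_rep_inj : quot (point_rep (None, a)) = quot (point_rep (Some 0, b)) by [].
  rewrite !quot_point_rep /= -ea -eb; apply/eqP; rewrite -subr_eq0; apply/eqP.
  by rewrite -[RHS](mulr0 k3^-1) -e /=; field; rewrite n1 n2 k30.
have [m1 m2 nu _ _] := trace0_basis nr.
move: e; rewrite k30 mul0r addr0 ruling_diff_some scale0r mul0r addr0 => e.
have [||||-> ->] := @indep3_inv _ _ m1 m2 nu k1 k2 0; rewrite ?fr0 //.
by rewrite mul0r addr0.
Qed.

Lemma exists_section_two_roots : exists g t1 t2,
  [/\ g != 0, fr t1 = t1, fr t2 = t2, t1 != t2 & forall t, fr t = t ->
    #|plane_section g t| = ((t1 == t) * q + (t2 == t) * q + q.-1)%N].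
Proof.
have [||| g [e1 e2 e3]] := @indep3_tr_dual _ _ _ 0 1 0 indep3_cofactors;
  rewrite ?fr1 ?fr0 //.
exists g, (tr (g * (ruling_rep None / ruling_diff None))),
  (tr (g * (ruling_rep (Some 0) / ruling_diff (Some 0)))).
have g0 : g != 0.
  by apply/eqP => g0; move/eqP: e2; rewrite g0 mul0r /tr !fr0 !addr0 eq_sym oner_eq0.
have tN : tr (g / ruling_diff None) = 0 by apply/eqP; rewrite tr_div_ruling_none e1.
have tS k : (tr (g / ruling_diff (Some k)) == 0) = (k == 0).
  by rewrite tr_div_ruling_some e1 e2 e3 mulr0 mulr1 add0r addr0 scalar1_eq0.
split; rewrite ?fr_tr //; first by apply: tr_two_rulings_neq => //; apply/eqP; rewrite tS.
move=> t ft; rewrite card_plane_section // sum_option (bigD1 0) //= addnA.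
rewrite /ruling_size tN tS !eqxx; congr (_ + _ + _)%N; try by case: eqP; rewrite ?mul1n.
rewrite (eq_bigr (fun _ => 1%N)); last by move=> k /negbTE k0; rewrite tS k0.
by rewrite sum1_card cardC1.
Qed.

End Rulings.

Lemma exists_plane_section_card x :
    x \in [:: q; q + 1; q + 2; 2 * q; 2 * q + 1]%N -> ~ (q = 2%N /\ x = 2%N) ->
  exists g t, [/\ g != 0, fr t = t & (#|plane_section g t|.+1)%N = x].
Proof.
have q1 : (1 < q)%N := finNzRing_gt1 F.
have [r nr] := exists_not_fixed.
have [g0 [t0 [g0n t0f c0]]] := exists_section_no_root nr.
have [g1 [t1 [g1n t1f c1]]] := exists_section_one_root nr false.
have [g2 [t2 [g2n t2f c2]]] := exists_section_one_root nr true.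
have [g [s1 [s2 [gn s1f s2f s12 cs]]]] := exists_section_two_roots nr.
rewrite !inE => /orP[/eqP xq|/orP[/eqP xq|/orP[/eqP xq|/orP[/eqP xq|/eqP xq]]]] nx.
- have q2 : (2 < q)%N by rewrite ltn_neqAle q1 andbT; apply/eqP => q2; apply: nx; lia.
  have [k] : exists k : F, k%:A \notin [:: s1; s2].
    apply/existsP; apply: contraLR q2; rewrite negb_exists -leqNgt => /forallP sk.
    have [l1 e1] := fr_fixed s1f; have [l2 e2] := fr_fixed s2f.
    have <- : #|[:: l1; l2]| = 2%N.
      apply/eqP; rewrite -[2%N]/(size [:: l1; l2]); apply/eqP/card_uniqP.
      by rewrite /= inE andbT; apply: contra s12 => /eqP l12; rewrite e1 e2 l12.
    apply/subset_leq_card/subsetP => k _.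
    by have := sk k; rewrite negbK !inE e1 e2 !(inj_eq scalar1_inj).
  rewrite !inE negb_or ![k%:A == _]eq_sym => /andP[/negbTE n1 /negbTE n2].
  by exists g, k%:A; rewrite fr_scalar cs ?fr_scalar // n1 n2; split=> //; lia.
- by exists g1, t1; split=> //; rewrite c1; lia.
- by exists g0, t0; split=> //; rewrite c0; lia.
- exists g, s1; split=> //; rewrite cs // eqxx [s2 == _]eq_sym (negbTE s12); lia.
- by exists g2, t2; split=> //; rewrite c2; lia.
Qed.

End CubicExtension.

(** * Points and linear sets *)

Section Geometry.

Local Open Scope ring_scope.

Variables (F : finFieldType) (L : fieldExtType F).
Hypothesis hL : \dim {:L} = 3%N.
Local Notation q := #|F|.
Local Notation K := (finvect_type L).
Local Notation vL := (vecL L).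
Local Notation vF := (vecF L).
Local Notation pt := (point L).
Let hK : \dim {:K} = 3%N := hL.

Lemma scaleFE (k : F) (v : vF) : k *: v = (k%:A : K) *: (v : vL) :> vL.
Proof. by case: v => x y; congr pair; rewrite /= -[LHS]mulr_algl. Qed.

Definition det (u v : vL) : K := u.1 * v.2 - u.2 * v.1.

Lemma vecL_eq (u v : vL) : u.1 = v.1 -> u.2 = v.2 -> u = v.
Proof. by case: u v => [? ?] [? ?] /= -> ->. Qed.

Lemma vscale1 (a : K) (u : vL) : (a *: u).1 = a * u.1. Proof. by []. Qed.
Lemma vscale2 (a : K) (u : vL) : (a *: u).2 = a * u.2. Proof. by []. Qed.
Lemma vadd1 (u v : vL) : (u + v).1 = u.1 + v.1. Proof. by []. Qed.
Lemma vadd2 (u v : vL) : (u + v).2 = u.2 + v.2. Proof. by []. Qed.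
Definition vE := (vscale1, vscale2, vadd1, vadd2).

Lemma det_comb a b c d u v : det (a *: u + b *: v) (c *: u + d *: v) = (a * d - b * c) * det u v.
Proof. by rewrite /det !vE; ring. Qed.

Lemma cramer u v w : det u v != 0 ->
  w = (det w v / det u v) *: u + (det u w / det u v) *: v.
Proof. by move=> n; apply: vecL_eq; rewrite !vE /det; field; exact: n. Qed.

Lemma comb_eq0 a b u v : det u v != 0 -> a *: u + b *: v = 0 -> a = 0 /\ b = 0.
Proof.
move=> n e; have e1 : det (a *: u + b *: v) v = 0 by rewrite e /det /= !mul0r subrr.
have e2 : det u (a *: u + b *: v) = 0 by rewrite e /det /= !mulr0 subrr.
split; apply: (mulIf n); rewrite mul0r.
  by rewrite -[RHS]e1 /det !vE; ring.
by rewrite -[RHS]e2 /det !vE; ring.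
Qed.

Lemma det_eq0 u v : u != 0 -> det u v = 0 -> exists l, v = l *: u.
Proof.
case: u v => [u1 u2] [v1 v2] n; rewrite /det /= => /eqP; rewrite subr_eq0 => /eqP e.
have [u10|u10] := eqVneq u1 0.
  have u20 : u2 != 0 by apply: contra n => /eqP u20; rewrite u10 u20.
  exists (v2 / u2); apply: vecL_eq; rewrite !vE /= ?divfK //.
  by apply: (mulfI u20); rewrite -e u10; ring.
exists (v1 / u1); apply: vecL_eq; rewrite !vE /= ?divfK //.
by apply: (mulfI u10); rewrite e; field.
Qed.

Lemma point_vector (X : pt) : exists2 v : vL, v != 0 & v \in val X.
Proof.
have dX : \dim (val X) = 1%N := eqP (valP X).
exists (vpick (val X)); last exact: memv_pick.
by rewrite vpick0 -dimv_eq0 dX.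
Qed.

Lemma point_line (X : pt) (v : vL) : v != 0 -> v \in val X -> val X = <[v]>%VS.
Proof.
move=> v0 vX; apply/eqP; rewrite eq_sym eqEdim -memvE vX dim_vline v0.
by rewrite (eqP (valP X)).
Qed.

Lemma point_eq (X Y : pt) (v : vL) : v != 0 -> v \in val X -> v \in val Y -> X = Y.
Proof. by move=> v0 /(point_line v0) eX /(point_line v0) eY; apply: val_inj; rewrite eX. Qed.

Lemma point_scale (X : pt) (v w : vL) : v != 0 -> v \in val X -> w \in val X ->
  exists l, w = l *: v.
Proof. by move=> v0 /(point_line v0) -> /vlineP. Qed.

Lemma point_det (X : pt) (v w : vL) : v != 0 -> v \in val X ->
  (w \in val X) = (det v w == 0).
Proof.
move=> v0 vX; apply/idP/eqP => [/(point_scale v0 vX) [l ->]|/(det_eq0 v0) [l ->]].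
  by rewrite /det !vE; ring.
exact: memvZ.
Qed.

Lemma exists_point (v : vL) : v != 0 -> exists X : pt, v \in val X.
Proof.
move=> v0; have dv : \dim <[v]>%VS == 1%N by rewrite dim_vline v0.
by exists (exist (fun X : {vspace vL} => \dim X == 1%N) _ dv); apply: memv_line.
Qed.

Lemma mem_field_reduction_cap (X : pt) (pi : {vspace vF}) (v : vF) :
  (v \in (field_reduction X :&: pi)%VS) = ((v : vL) \in val X) && (v \in pi).
Proof. by rewrite memv_cap mem_field_reduction. Qed.

Lemma linear_setP (pi : {vspace vF}) (X : pt) :
  reflect (exists v : vF, [/\ v != 0, v \in pi & (v : vL) \in val X])
          (X \in linear_set pi).
Proof.
rewrite inE; apply: (iffP idP) => [n|[v [v0 vp vX]]].
  exists (vpick (field_reduction X :&: pi)); rewrite vpick0.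
  by have := memv_pick (field_reduction X :&: pi); rewrite mem_field_reduction_cap => /andP[].
have : v \in (field_reduction X :&: pi)%VS by rewrite mem_field_reduction_cap vX.
by apply: contraTneq => ->; rewrite memv0.
Qed.

Lemma field_reduction_inj : injective (@field_reduction F L).
Proof.
move=> X Y e; have [v v0 vX] := point_vector X; apply: (point_eq v0 vX).
by rewrite -mem_field_reduction -e mem_field_reduction.
Qed.

Lemma card_spread_meet (pi : {vspace vF}) :
  #|[set alpha in spread L | (alpha :&: pi)%VS != 0%VS]| = #|linear_set pi|.
Proof.
rewrite -(card_imset _ field_reduction_inj); apply: eq_card => alpha.
rewrite inE; apply/andP/imsetP => [[/imsetP [X _ ->]]|[X]] n; first by exists X; rewrite ?inE.
by rewrite inE in n *; move=> ->; rewrite imset_f.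
Qed.

Lemma card_vF (U : {vspace vF}) : #|[set v : finvect_type vF | v \in U]| = (q ^ \dim U)%N.
Proof.
rewrite -(@card_vspace F (finvect_type vF) (Vector.class (finvect_type vF))).
by apply: eq_card => v; rewrite inE.
Qed.

(** Two vectors of [pi] in the same point are proportional over [F]: the bound 1 on
    the dimensions of [scatteredP], in terms of vectors. *)
Definition scattered (pi : {vspace vF}) := forall v w : vF,
  v \in pi -> w \in pi -> v != 0 -> det v w = 0 -> exists k : F, w = k *: v.

Lemma dim_le1P (U : {vspace vF}) :
  (forall v w, v \in U -> w \in U -> v != 0 -> exists k : F, w = k *: v) <-> (\dim U <= 1)%N.
Proof.
split=> [h|].
  have [->|U0] := eqVneq U 0%VS; first by rewrite dimv0.
  have pU : vpick U != 0 by rewrite vpick0.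
  suff : (U <= <[vpick U]>)%VS by move/dimvS; rewrite dim_vline pU.
  apply/subvP => w wU; have [k ->] := h _ w (memv_pick U) wU pU.
  by apply: memvZ; apply: memv_line.
move=> dU v w vU wU v0; apply/vlineP; suff <- : U = <[v]>%VS by [].
by apply/eqP; rewrite eq_sym eqEdim -memvE vU dim_vline v0.
Qed.

Lemma scatteredP (pi : {vspace vF}) :
  scattered pi <-> forall X : pt, (\dim (field_reduction X :&: pi) <= 1)%N.
Proof.
split=> [sc X|h v w vp wp v0 dvw].
  apply/dim_le1P => v w.
  rewrite [v \in _]mem_field_reduction_cap [w \in _]mem_field_reduction_cap.
  move=> /andP[vX vp] /andP[wX wp] v0.
  by apply: (sc v w vp wp v0); apply/eqP; rewrite -(point_det w v0 vX).
have [X vX] := exists_point v0; have /dim_le1P := h X; apply=> //.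
- by rewrite mem_field_reduction_cap vX.
- by rewrite mem_field_reduction_cap wp andbT (point_det w v0 vX) dvw.
Qed.

(** Every nonzero vector of [pi] lies in exactly one point. *)
Lemma sum_linear_set (pi : {vspace vF}) :
  (\sum_(X in linear_set pi) (q ^ \dim (field_reduction X :&: pi) - 1) = q ^ \dim pi - 1)%N.
Proof.
have cardU (U : {vspace vF}) :
    (q ^ \dim U - 1 = \sum_(v : finvect_type vF) ((v \in U) && (v != 0%R)))%N.
  rewrite -card_vF (cardsD1 (0 : finvect_type vF)) inE mem0v add1n subn1 /=.
  rewrite -sum1_card big_mkcond /=; apply: eq_bigr => v _.
  by rewrite !inE andbC; case: (_ && _).
rewrite cardU; under eq_bigr do rewrite cardU.
rewrite exchange_big /=; apply: eq_bigr => v _.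
have [vp|] := boolP ((v \in pi) && (v != 0)); last first.
  rewrite negb_and negbK => vp; apply: big1 => X _; rewrite memv_cap.
  by case/orP: vp => [/negbTE -> | /eqP ->]; rewrite ?andbF ?eqxx ?andbF.
case/andP: vp => vp v0; have [X vX] := exists_point v0.
have Xl : X \in linear_set pi by apply/linear_setP; exists v.
rewrite (bigD1 X) //= memv_cap mem_field_reduction vX vp v0 big1 // => Y /andP[_ nYX].
rewrite mem_field_reduction_cap; apply/eqP; rewrite eqb0; apply/negP => /andP[/andP[vY _] _].
by case/eqP: nYX; apply: (point_eq v0).
Qed.

(** Each of the terms of [sum_linear_set] is at least [q - 1], and their sum is
    [(q - 1) * (q ^ 2 + q + 1)]: there are [q ^ 2 + q + 1] terms exactly when all
    of them are equal to [q - 1]. *)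
Lemma card_linear_set_scattered (pi : {vspace vF}) : \dim pi = 3%N ->
  (#|linear_set pi| = q ^ 2 + q + 1)%N <-> scattered pi.
Proof.
move=> dpi; have q1 : (1 < q)%N := finNzRing_gt1 F.
have := sum_linear_set pi; rewrite dpi => sm.
have d0 X : X \in linear_set pi -> (0 < \dim (field_reduction X :&: pi))%N.
  by rewrite inE lt0n dimv_eq0.
have e3 : (q ^ 3 - 1 = (q ^ 2 + q + 1) * (q - 1))%N by rewrite !expnS expn0; nia.
have le1 X : X \in linear_set pi ->
    (q - 1 <= q ^ \dim (field_reduction X :&: pi) - 1)%N.
  by move=> /d0 dX; rewrite leq_sub2r // -{1}[q]expn1 leq_exp2l.
split=> [cd|/scatteredP sc].
  apply/scatteredP => X; rewrite leqNgt; apply/negP => dX.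
  have Xl : X \in linear_set pi by rewrite inE -dimv_eq0 -lt0n; apply: leq_trans dX.
  move: sm; rewrite e3 -cd -sum_nat_const; apply/eqP; rewrite neq_ltn; apply/orP; right.
  have ltX : (q - 1 < q ^ \dim (field_reduction X :&: pi) - 1)%N.
    have := leq_pexp2l (ltnW q1) dX; rewrite expnS expn1.
    by move: (q ^ _)%N => m; clear -q1; nia.
  rewrite (bigD1 X) //= [ltnRHS](bigD1 X) //= -addSn; apply: (leq_add ltX).
  by apply: leq_sum => Y /andP[/le1].
apply/eqP; rewrite -(eqn_pmul2r (_ : 0 < q - 1)%N) ?subn_gt0 // -e3 -sm -sum_nat_const.
apply/eqP; apply: eq_bigr => X Xl; congr subn.
by have /eqP -> : \dim (field_reduction X :&: pi) == 1%N by rewrite eqn_leq sc d0.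
Qed.

(** * Normal forms of maximum scattered linear sets and clubs *)

Definition scattered_param (S : {set pt}) (e e' : vL) := forall X : pt,
  X \in S <-> exists2 x : K, x != 0 & x *: e + fr x *: e' \in val X.

Definition club_param (C : {set pt}) (h p : vL) := forall X : pt,
  X \in C <-> exists w t : K,
    [/\ tr w = 0, fr t = t, w *: h + t *: p != 0 & w *: h + t *: p \in val X].

Lemma exists_plane (f : K -> vF) :
    (forall (k : F) x y, f (k *: x + y) = k *: f x + f y) ->
    (forall x, f x = 0 -> x = 0) ->
  exists pi : {vspace vF}, \dim pi = 3%N /\ forall v, v \in pi <-> exists x : K, v = f x.
Proof.
move=> flin finj.
pose fL : {linear K -> vF} := HB.pack f (GRing.isLinear.Build F K vF _ f flin).
exists (limg (linfun fL)); split.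
  rewrite limg_dim_eq; first exact: hL.
  apply/eqP; rewrite -subv0; apply/subvP => x; rewrite memv_cap memv_ker lfunE /= memv0.
  by case/andP => _ /eqP/finj ->.
move=> v; split=> [/memv_imgP [x _ ->]|[x ->]].
  by exists x; rewrite lfunE.
by apply/memv_imgP; exists x; rewrite ?memvf // lfunE.
Qed.

Lemma not_spread (pi : {vspace vF}) v w : v \in pi -> w \in pi -> det v w != 0 ->
  pi \notin spread L.
Proof.
move=> vp wp; apply: contra => /imsetP [X _ e].
have vX : (v : vL) \in val X by rewrite -mem_field_reduction -e.
have wX : (w : vL) \in val X by rewrite -mem_field_reduction -e.
have [v0|v0] := eqVneq v 0; first by rewrite v0 /det /= !mul0r subrr.
by rewrite -(point_det w v0 vX).
Qed.

(** If [y = l x] and [fr y = l (fr x)], then [l] is fixed by [fr]. *)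
Lemma exists_max_scattered (e e' : vL) : det e e' != 0 ->
  exists S : {set pt}, max_scattered S /\ scattered_param S e e'.
Proof.
move=> n.
pose f (x : K) : vF := x *: e + fr x *: e'.
have [] := @exists_plane f.
- move=> k x y; rewrite scaleFE /f frD -(mulr_algl k x) frM fr_scalar.
  by rewrite !scalerDl scalerDr !scalerA addrACA.
- by move=> x /(comb_eq0 n) [].
move=> pi [dpi pip]; exists (linear_set pi); split; last first.
  move=> X; split=> [/linear_setP [v [v0 /pip [x ex] vX]]|[x x0 fX]].
    exists x; last by rewrite -[_ + _]/(f x) -ex.
    by apply: contra v0 => /eqP x0; rewrite ex x0 /f fr0 !scale0r addr0.
  apply/linear_setP; exists (f x); split=> //; last by apply/pip; exists x.
  by apply: contra x0 => /eqP/(comb_eq0 n) [-> _].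
have sc : scattered pi.
  move=> v w /pip [x ->] /pip [y ->] v0; rewrite det_comb => /eqP.
  rewrite mulf_eq0 (negbTE n) orbF subr_eq0 => /eqP exy.
  have x0 : x != 0 by apply: contra v0 => /eqP ->; rewrite /f fr0 !scale0r addr0.
  have [|k ek] := @fr_fixed F K (y / x).
    by apply: (fr_ratio hK) => //; rewrite mulrC exy mulrC.
  have fk : fr (k%:A : K) = k%:A by exact: fr_scalar.
  exists k; rewrite scaleFE /f.
  have -> : y = k%:A * x by rewrite -ek divfK.
  by rewrite frM fk scalerDr !scalerA.
exists pi; split=> //; last by rewrite card_spread_meet; apply/card_linear_set_scattered.
have [r nr] := exists_not_fixed hK.
apply: (@not_spread pi (f 1) (f r)); try by apply/pip; eexists.
by rewrite det_comb fr1 !mul1r; apply: mulf_neq0 => //; rewrite subr_eq0.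
Qed.

Lemma det_comb_l (a b : K) (u v : vL) : det u (a *: u + b *: v) = b * det u v.
Proof. by rewrite /det !vE; ring. Qed.

Lemma exists_club (h p : vL) (H : pt) : det h p != 0 -> h \in val H ->
  exists C : {set pt}, club_with_head C H /\ club_param C h p.
Proof.
move=> n hH; have [th tth] := tr_onto hK (fr1 L).
have h0 : h != 0 by apply: contra n => /eqP ->; rewrite /det /= !mul0r subrr.
have p0 : p != 0 by apply: contra n => /eqP ->; rewrite /det /= !mulr0 subrr.
(* Splitting [x] along [th], of trace 1, parametrizes the pairs [(w, t)] by [K]. *)
pose f (x : K) : vF := (x - tr x * th) *: h + tr x *: p.
have fr_sc (k : F) : fr (k%:A : K) = k%:A by exact: fr_scalar.
have [] := @exists_plane f.
- move=> k x y; rewrite scaleFE /f trD // -(mulr_algl k x) trZ //.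
  have -> : k%:A * x + y - (k%:A * tr x + tr y) * th
     = k%:A * (x - tr x * th) + (y - tr y * th) by ring.
  move: (x - tr x * th) (y - tr y * th) => c d.
  by rewrite 2!scalerDl scalerDr !scalerA addrACA.
- by move=> x /(comb_eq0 n) [/eqP + tx]; rewrite tx mul0r subr0 => /eqP.
move=> pi [dpi pip].
have mem_pi v : v \in pi <-> exists w t : K, [/\ tr w = 0, fr t = t & v = w *: h + t *: p].
  rewrite pip; split=> [[x ->]|[w [t [tw ft ->]]]].
    exists (x - tr x * th), (tr x); rewrite fr_tr //; split=> //.
    by rewrite trB (trZ _ (fr_tr hK x)) tth mulr1 subrr.
  by exists (w + t * th); rewrite /f trD // (trZ _ ft) tw tth mulr1 add0r addrK.
have pX w t : (w *: h + t *: p \in val H) = (t == 0).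
  by rewrite (point_det _ h0 hH) det_comb_l mulf_eq0 (negbTE n) orbF.
have dH : \dim (field_reduction H :&: pi)%VS = 2%N.
  set U := (_ :&: _)%VS.
  have p_pi : (p : vF) \in pi.
    by apply/mem_pi; exists 0, 1; rewrite /tr !fr0 !addr0 fr1 scale0r scale1r add0r.
  have leU : (\dim U <= 3)%N by rewrite -dpi dimvS // capvSr.
  have neU : \dim U != 3%N.
    apply/eqP => dU; have : (p : vF) \in U.
      by rewrite (_ : U = pi) //; apply/eqP; rewrite eqEdim capvSr dpi dU.
    rewrite mem_field_reduction_cap => /andP[pH _].
    by have := pX 0 1; rewrite scale0r scale1r add0r pH oner_eq0.
  have geU : (3 <= \dim U + 1)%N.
    rewrite -dpi; have <- : \dim <[p : vF]>%VS = 1%N by rewrite dim_vline p0.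
    apply: (leq_trans (dimvS _) (dimv_add_leqif U <[p : vF]>%VS).1).
    apply/subvP => v /mem_pi [w [t [tw ft ->]]].
    have [k ek] := fr_fixed ft.
    apply: memv_add; last by rewrite ek -scaleFE; apply: memvZ; apply: memv_line.
    have wH : w *: h \in val H by have := pX w 0; rewrite (scale0r p) (addr0 (w *: h)) eqxx.
    rewrite [_ \in U]mem_field_reduction_cap wH /=.
    by apply/mem_pi; exists w, 0; rewrite fr0 scale0r addr0.
  by lia.
have dX X : X != H -> (\dim (field_reduction X :&: pi)%VS <= 1)%N.
  move=> nXH; apply/dim_le1P => v v'; rewrite [v \in _]mem_field_reduction_cap.
  rewrite [v' \in _]mem_field_reduction_cap => /andP[vX /mem_pi [w [t [tw ft ev]]]].
  move=> /andP[vX' /mem_pi [w' [t' [tw' ft' ev']]]] v0.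
  have t0 : t != 0.
    by rewrite -(pX w) -ev; apply: contra nXH => vH; apply/eqP/(point_eq v0).
  have [l el] := point_scale v0 vX vX'.
  have et : t' = l * t.
    by apply: (mulIf n); rewrite -(det_comb_l w') -ev' el ev /det !vE; ring.
  have [|k ek] := @fr_fixed F K l.
    by rewrite -(mulfK t0 l) -et frM frV ft ft'.
  by exists k; rewrite el ek scaleFE.
exists (linear_set pi); split; last first.
  move=> X; split=> [/linear_setP [v [v0 /mem_pi [w [t [tw ft ev]]] vX]]|[w [t [tw ft v0 vX]]]].
    by exists w, t; rewrite -ev.
  by apply/linear_setP; exists (w *: h + t *: p); split=> //; apply/mem_pi; exists w, t.
exists pi; split=> //; last first.
  move=> alpha /imsetP [X _ ->]; split=> [d2|/field_reduction_inj -> //].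
  congr field_reduction; apply/eqP; apply: contraLR (_ : (1 < 2)%N) => //.
  by move/dX; rewrite d2.
have [u [u0 tu _]] := exists_trace0_inv hK (oner_neq0 L).
apply: (@not_spread pi (u *: h) p).
- by apply/mem_pi; exists u, 0; rewrite fr0 scale0r addr0.
- by apply/mem_pi; exists 0, 1; rewrite /tr !fr0 !addr0 fr1 scale0r scale1r add0r.
- have -> : det (u *: h) p = u * det h p by rewrite /det !vE; ring.
  exact: mulf_neq0.
Qed.

Lemma dim3_basis (pi : {vspace vF}) : \dim pi = 3%N -> exists u1 u2 u3 : vF,
  (forall v, v \in pi <-> exists k1 k2 k3 : F, v = k1 *: u1 + k2 *: u2 + k3 *: u3)
  /\ (forall k1 k2 k3 : F, k1 *: u1 + k2 *: u2 + k3 *: u3 = 0 ->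
        [/\ k1 = 0, k2 = 0 & k3 = 0]).
Proof.
move=> dpi; have := vbasisP pi; move: (vbasis pi); rewrite dpi => b.
case/tupleP: b => u1 b; case/tupleP: b => u2 b; case/tupleP: b => u3 b.
rewrite (tuple0 b) => /andP[/eqP sp fr3].
exists u1, u2, u3; split=> [v|k1 k2 k3 e].
  rewrite -sp /= !span_cons span_nil addv0; split.
    case/memv_addP => _ /vlineP [k1 ->] [_ /memv_addP [_ /vlineP [k2 ->] [_ /vlineP [k3 ->] ->]] ->].
    by exists k1, k2, k3; rewrite addrA.
  case=> [k1 [k2 [k3 ->]]]; rewrite -addrA; apply: memv_add; first exact/memvZ/memv_line.
  by apply: memv_add; exact/memvZ/memv_line.
move/freeP: fr3 => /(_ (fun i => nth 0 [:: k1; k2; k3] i)) fr3.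
have fr3' i : nth 0 [:: k1; k2; k3] (i : 'I_3) = 0.
  by apply: fr3; rewrite !big_ord_recl big_ord0 /= addr0 addrA.
by split; [exact: (fr3' ord0) | exact: (fr3' (@Ordinal 3 1 isT)) | exact: (fr3' (@Ordinal 3 2 isT))].
Qed.

Lemma vscaleF1 (k : F) (u : vF) : (k *: u).1 = k%:A * u.1.
Proof. by rewrite mulr_algl. Qed.
Lemma vscaleF2 (k : F) (u : vF) : (k *: u).2 = k%:A * u.2.
Proof. by rewrite mulr_algl. Qed.

(** The left-hand side is [det v w / k3] for the combinations [v] and [w] that
    eliminate [u3]: two vectors of [pi], independent over [F], would lie in the same
    point. *)
Lemma scattered_cofactor (pi : {vspace vF}) (u1 u2 u3 : vF) : scattered pi ->
    (forall k1 k2 k3 : F, k1 *: u1 + k2 *: u2 + k3 *: u3 \in pi) ->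
    (forall k1 k2 k3 : F, k1 *: u1 + k2 *: u2 + k3 *: u3 = 0 ->
        [/\ k1 = 0, k2 = 0 & k3 = 0]) ->
  forall k1 k2 k3 : F,
    k1%:A * det u2 u3 + k2%:A * det u3 u1 + k3%:A * det u1 u2 = 0 -> k3 = 0.
Proof.
move=> sc mem free k1 k2 k3 e; apply/eqP/negP => /negP k30.
pose v : vF := k3 *: u1 + 0 *: u2 + (- k1) *: u3.
pose w : vF := 0 *: u1 + k3 *: u2 + (- k2) *: u3.
have v0 : v != 0 by apply: contra k30 => /eqP /free [-> _ _].
have dvw : det v w = 0.
  rewrite -[RHS](mulr0 k3%:A) -e /det /v /w.
  rewrite -!/(fst _) -!/(snd _).
  have c1 (a b c : F) : (a *: u1 + b *: u2 + c *: u3 : vF).1 = a%:A * u1.1 + b%:A * u2.1 + c%:A * u3.1.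
    by rewrite -!vscaleF1.
  have c2 (a b c : F) : (a *: u1 + b *: u2 + c *: u3 : vF).2 = a%:A * u1.2 + b%:A * u2.2 + c%:A * u3.2.
    by rewrite -!vscaleF2.
  by rewrite !c1 !c2 !scaleNr !scale0r; ring.
have [k ew] := sc v w (mem _ _ _) (mem _ _ _) v0 dvw.
have [] := free (k * k3) (- k3) (k2 - k * k1).
  have -> : 0 = k *: v - w by rewrite ew subrr.
  rewrite /v /w !scale0r addr0 add0r !scaleNr scalerBr opprB !scalerA scalerBl -!addrA.
  by congr (_ + _); rewrite [LHS]addrC addrAC [LHS]addrC.
by move=> _ /eqP; rewrite oppr_eq0 (negbTE k30).
Qed.

(** Three vectors [u_i] that span [pi] over [F] satisfy one linear relation over
    [L], whose coefficients [c_i] are the cofactors [det u_j u_k]. They are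
    independent over [F] because [pi] is scattered. Hence every vector of [pi] is
    [\sum_i tr (x c_i) u_i] for some [x]. Expanding the trace gives
    [x (\sum_i c_i u_i) + fr x e + fr (fr x) e'], and the first term is 0. *)
Lemma max_scattered_param_exists (S : {set pt}) : max_scattered S ->
  exists e e' : vL, det e e' != 0 /\ scattered_param S e e'.
Proof.
case=> pi [dpi _ cd ->]; rewrite card_spread_meet in cd.
have /(card_linear_set_scattered dpi) sc := cd.
have [u1 [u2 [u3 [bas free]]]] := dim3_basis dpi.
have mem k1 k2 k3 : k1 *: u1 + k2 *: u2 + k3 *: u3 \in pi by apply/bas; exists k1, k2, k3.
pose c1 := det u2 u3; pose c2 := det u3 u1; pose c3 := det u1 u2.
have rot (V : zmodType) (x y z : V) : x + y + z = z + x + y by rewrite addrC addrA.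
have ind : @indep3 F K c1 c2 c3.
  move=> _ _ _ /fr_fixed [k1 ->] /fr_fixed [k2 ->] /fr_fixed [k3 ->] e.
  have k30 : k3 = 0 by apply: (scattered_cofactor sc mem free e).
  have k20 : k2 = 0.
    apply: (@scattered_cofactor pi u3 u1 u2 sc _ _ k3 k1 k2); last by rewrite -rot.
      by move=> *; rewrite -rot.
    by move=> a b c; rewrite -rot => /free [].
  have k10 : k1 = 0.
    apply: (@scattered_cofactor pi u2 u3 u1 sc _ _ k2 k3 k1); last by rewrite rot.
      by move=> *; rewrite rot.
    by move=> a b c; rewrite rot => /free [].
  by rewrite k10 k20 k30 scale0r.
pose comb (a b c : K) : vL := a *: (u1 : vL) + b *: (u2 : vL) + c *: (u3 : vL).
pose e := comb (fr c1) (fr c2) (fr c3).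
pose e' := comb (fr (fr c1)) (fr (fr c2)) (fr (fr c3)).
have comb0 : comb c1 c2 c3 = 0.
  by apply: vecL_eq; rewrite /comb /c1 /c2 /c3 /det !vE; ring.
have combE x : fr x *: e + fr (fr x) *: e' = comb (tr (x * c1)) (tr (x * c2)) (tr (x * c3)).
  rewrite -[LHS]add0r -(scaler0 _ x) -comb0 /e /e' /comb /tr !frM.
  move: (c1) (c2) (c3) (u1 : vL) (u2 : vL) (u3 : vL) => d1 d2 d3 w1 w2 w3.
  by apply: vecL_eq; rewrite !vE; ring.
have combF (k1 k2 k3 : F) : comb k1%:A k2%:A k3%:A = k1 *: u1 + k2 *: u2 + k3 *: u3.
  by rewrite /comb -!scaleFE.
have pip v : v \in pi <-> exists x : K, v = fr x *: e + fr (fr x) *: e'.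
  split=> [/bas [k1 [k2 [k3 ->]]]|[x ->]].
    have [||| g [t1 t2 t3]] := @indep3_tr_dual F K hK _ _ _ k1%:A k2%:A k3%:A ind;
      rewrite ?fr_scalar //.
    by exists g; rewrite combE t1 t2 t3 combF.
  rewrite combE; have [k1 ->] := fr_fixed (fr_tr hK (x * c1)).
  have [k2 ->] := fr_fixed (fr_tr hK (x * c2)); have [k3 ->] := fr_fixed (fr_tr hK (x * c3)).
  by rewrite combF.
have n : det e e' != 0.
  apply/negP => /eqP ee.
  have pd v w : v \in pi -> w \in pi -> det v w = 0.
    by move=> /pip [x ->] /pip [y ->]; rewrite det_comb ee mulr0.
  have [||||_ _ /eqP] := ind 0 0 1; rewrite ?fr0 ?fr1 ?oner_eq0 //.
  rewrite !mul0r !add0r mul1r; apply: pd; apply/bas.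
    by exists 1, 0, 0; rewrite scale1r !scale0r !addr0.
  by exists 0, 1, 0; rewrite scale1r !scale0r addr0 add0r.
exists e, e'; split=> // X; split=> [/linear_setP [v [v0 /pip [x ex] vX]]|[x x0 xX]].
  exists (fr x); last by rewrite -ex.
  by apply: contra v0 => /eqP x0; rewrite ex x0 fr0 !scale0r addr0.
apply/linear_setP; exists (x *: e + fr x *: e'); split=> //.
  by apply: contra x0 => /eqP/(comb_eq0 n) [-> _].
by apply/pip; exists (fr (fr x)); rewrite fr3.
Qed.

Lemma dim2_basis (U : {vspace vF}) : \dim U = 2%N -> exists u1 u2 : vF,
  (forall v, v \in U <-> exists k1 k2 : F, v = k1 *: u1 + k2 *: u2)
  /\ (forall k1 k2 : F, k1 *: u1 + k2 *: u2 = 0 -> k1 = 0 /\ k2 = 0).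
Proof.
move=> dU; have := vbasisP U; move: (vbasis U); rewrite dU => b.
case/tupleP: b => u1 b; case/tupleP: b => u2 b.
rewrite (tuple0 b) => /andP[/eqP sp fr2].
exists u1, u2; split=> [v|k1 k2 e].
  rewrite -sp /= !span_cons span_nil addv0; split.
    case/memv_addP => _ /vlineP [k1 ->] [_ /vlineP [k2 ->] ->].
    by exists k1, k2.
  by case=> [k1 [k2 ->]]; apply: memv_add; exact/memvZ/memv_line.
move/freeP: fr2 => /(_ (fun i => nth 0 [:: k1; k2] i)) fr2.
have fr2' i : nth 0 [:: k1; k2] (i : 'I_2) = 0.
  by apply: fr2; rewrite !big_ord_recl big_ord0 /= addr0.
by split; [exact: (fr2' ord0) | exact: (fr2' (@Ordinal 2 1 isT))].
Qed.

(** The vectors of [pi] in the head are the [y h0] for [y] in an [F]-plane of [L].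
    This plane is the kernel of [y => tr (g * y)] for some [g], and [h] is [h0]
    rescaled by [g]. *)
Lemma club_param_exists (C : {set pt}) (H : pt) : club_with_head C H ->
  exists h p : vL, [/\ det h p != 0, h \in val H & club_param C h p].
Proof.
case=> pi [dpi _ hd ->]; set U := (field_reduction H :&: pi)%VS.
have dU : \dim U = 2%N by apply/hd => //; apply: imset_f.
have [b1 [b2 [bas free]]] := dim2_basis dU.
have [h0 h00 h0H] := point_vector H.
have memU v : v \in U -> exists y, v = y *: h0.
  by rewrite mem_field_reduction_cap => /andP[vH _]; apply: point_scale vH.
have [y1 e1] : exists y, b1 = y *: h0.
  by apply: memU; apply/bas; exists 1, 0; rewrite scale1r scale0r addr0.
have [y2 e2] : exists y, b2 = y *: h0.
  by apply: memU; apply/bas; exists 0, 1; rewrite scale1r scale0r add0r.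
have comb2 (k1 k2 : F) : k1 *: b1 + k2 *: b2 = (k1%:A * y1 + k2%:A * y2) *: h0 :> vL.
  by rewrite [RHS]scalerDl -2!scalerA -e1 -e2 -2!scaleFE.
have free' (k1 k2 : F) : k1%:A * y1 + k2%:A * y2 = 0 -> k1 = 0 /\ k2 = 0.
  move=> e.
  have e0 := comb2 k1 k2.
  rewrite e in e0.
 rewrite [RHS]scale0r in e0.
  exact: (free k1 k2 e0).
pose g := fr y1 * fr (fr y2) - fr (fr y1) * fr y2.
have g0 : g != 0.
  have -> : g = fr (y1 * fr y2 - fr y1 * y2) by rewrite /g frD frN !frM.
  rewrite (fr_eq0 hK) subr_eq0; apply/eqP => ey.
  have [y20|y20] := eqVneq y2 0.
    have [|_ /eqP] := free' 0 1; rewrite ?oner_eq0 //.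
    by rewrite y20 mulr0 scale0r mul0r addr0.
  have [|k ek] := @fr_fixed F K (y1 / y2); first exact: fr_ratio.
  have [|/eqP] := free' 1 (- k); rewrite ?oner_eq0 //.
  by rewrite scaleNr scale1r -ek; field.
have t1 : tr (g * y1) = 0 by rewrite /tr /g !(frE hK); ring.
have t2 : tr (g * y2) = 0 by rewrite /tr /g !(frE hK); ring.
have [th tth] := tr_onto hK (fr1 K).
have trcomb k1 k2 : fr k1 = k1 -> fr k2 = k2 -> tr (k1 * (g * y1) + k2 * (g * y2)) = 0.
  by move=> f1 f2; rewrite trD (trZ _ f1) (trZ _ f2) t1 t2 !mulr0 addr0.
have ind : @indep3 F K (g * y1) (g * y2) th.
  move=> k1 k2 k3 f1 f2 f3 e; have := congr1 (@tr F K) e.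
  rewrite trD trcomb // (trZ _ f3) tth mulr1 add0r /tr !fr0 !addr0 => k30.
  move: f1 f2 e => /fr_fixed [l1 ->] /fr_fixed [l2 ->]; rewrite k30 mul0r addr0 => e.
  have [|-> ->] := free' l1 l2; last by rewrite scale0r.
  by apply: (mulfI g0); rewrite mulr0 -[RHS]e; ring.
pose h : vL := g^-1 *: h0.
have hH : h \in val H by apply: memvZ.
have hN0 : h != 0 by rewrite scaler_eq0 invr_eq0 (negbTE g0).
have combh (k1 k2 : F) :
    (k1%:A * (g * y1) + k2%:A * (g * y2)) *: h = k1 *: b1 + k2 *: b2 :> vL.
  rewrite comb2 /h scalerA.
  by rewrite (_ : _ / g = k1%:A * y1 + k2%:A * y2) //; field.
have Uw v : v \in U <-> exists w, tr w = 0 /\ v = w *: h.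
  split=> [/bas [k1 [k2 ->]]|[w [tw ->]]].
    exists (k1%:A * (g * y1) + k2%:A * (g * y2)).
    split; [by rewrite trcomb ?fr_scalar | exact: esym (combh k1 k2)].
  have [k1 [k2 [k3 [f1 f2 f3 ew]]]] := indep3_span hK w ind.
  have k30 : k3 = 0 by move: tw; rewrite ew trD trcomb // (trZ _ f3) tth mulr1 add0r.
  move: f1 f2 ew => /fr_fixed [l1 ->] /fr_fixed [l2 ->]; rewrite k30 mul0r addr0 => ->.
  by apply/bas; exists l1, l2; exact: combh.
have [p p_pi pU] : exists2 p, p \in pi & p \notin U.
  apply/subvPn; apply/negP => /dimvS; by rewrite dpi dU.
have pH : (p : vL) \notin val H by apply: contra pU => pH; rewrite mem_field_reduction_cap pH.
have p0 : p != 0 by apply: contra pH => /eqP ->; apply: mem0v.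
have n : det h p != 0 by rewrite -(point_det _ hN0 hH).
have piE : pi = (U + <[p]>)%VS.
  apply/esym/eqP; rewrite eqEdim subv_add capvSr -memvE p_pi dpi /=.
  rewrite -addn1 -[1%N]/(true : nat) -dU -p0 -dim_vline -(dimv_disjoint_sum _) //.
  apply/eqP; rewrite -subv0; apply/subvP => v; rewrite memv_cap memv0 => /andP[vU /vlineP [k ev]].
  rewrite ev scaler_eq0 (negbTE p0) orbF; apply: contraLR pU => k0; rewrite negbK.
  by rewrite -(scalerK k0 p) -ev memvZ.
have pip v : v \in pi <-> exists w t : K, [/\ tr w = 0, fr t = t & v = w *: h + t *: (p : vL)].
  rewrite piE; split=> [/memv_addP [_ /Uw [w [tw ->]] [_ /vlineP [k ->] ->]]|[w [t [tw /fr_fixed [k ->] ->]]]].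
    by exists w, k%:A; rewrite fr_scalar -scaleFE.
  apply: memv_add; first by apply/Uw; exists w.
  by rewrite -scaleFE; apply: memvZ; apply: memv_line.
exists h, p; split=> // X; split=> [/linear_setP [v [v0 /pip [w [t [tw ft ev]]] vX]]|[w [t [tw ft v0 vX]]]].
  by exists w, t; rewrite -ev.
by apply/linear_setP; exists (w *: h + t *: (p : vL)); split=> //; apply/pip; exists w, t.
Qed.

(** * Intersections *)

Lemma pair_neq0 (a b : K) : ((a, b) != 0 :> vL) = (a != 0) || (b != 0).
Proof. by rewrite -negb_and. Qed.

Definition aff (y : K) : vL := (y, 1).

Lemma aff_neq0 y : aff y != 0.
Proof. by rewrite /aff pair_neq0 oner_neq0 orbT. Qed.

Lemma dim_aff y : \dim <[aff y]>%VS == 1%N.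
Proof. by rewrite dim_vline aff_neq0. Qed.

Definition affpt (y : K) : pt :=
  exist (fun X : {vspace vL} => \dim X == 1%N) <[aff y]>%VS (dim_aff y).

Lemma mem_affpt y (v : vL) : (v \in val (affpt y)) = (v.1 == y * v.2).
Proof.
rewrite (@point_det (affpt y) _ v (aff_neq0 y) (memv_line _)) /det /aff /=.
by rewrite mul1r subr_eq0 eq_sym.
Qed.

Lemma affpt_inj : injective affpt.
Proof.
move=> y z e; have := mem_affpt z (aff y); rewrite -e memv_line /= mulr1.
by move/esym/eqP.
Qed.

Lemma affptE (X : pt) (v : vL) y : v != 0 -> v \in val X -> v.1 = y * v.2 -> X = affpt y.
Proof.
move=> v0 vX e; apply: (point_eq v0 vX); rewrite mem_affpt; exact/eqP.
Qed.

(** The head is the point [h = (1, 0)] at infinity. The point [aff y] is in [S] when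
    [y] is on the quadric, and in [C] when [tr (g * y) = t]. *)
Lemma exists_meet_card x :
    x \in [:: q; q + 1; q + 2; 2 * q; 2 * q + 1]%N -> ~ (q = 2%N /\ x = 2%N) ->
  exists S C : {set pt}, [/\ max_scattered S, club C & #|S :&: C| = x].
Proof.
move=> xl nx; have [g [t [g0 ft <-]]] := exists_plane_section_card hL xl nx.
have [th tth] := tr_onto hK (fr1 K).
pose e : vL := (1, -1); pose e' : vL := (0, 1).
have ne : det e e' != 0 by rewrite /det /= mulr1 mulr0 subr0 oner_neq0.
have [S [msS SP]] := exists_max_scattered ne.
pose h : vL := (g^-1, 0); pose p : vL := (t * th / g, 1).
have nh : det h p != 0 by rewrite /det /= mulr1 mul0r subr0 invr_eq0.
have h0 : h != 0 by rewrite pair_neq0 invr_eq0 g0.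
have [H hH] := exists_point h0.
have [C [clC CP]] := exists_club nh hH.
have memH (v : vL) : (v \in val H) = (v.2 == 0).
  by rewrite (point_det v h0 hH) /det /= mul0r subr0 mulf_eq0 invr_eq0 (negbTE g0).
exists S, C; split=> //; first by exists H.
have vS (z : K) : z *: e + fr z *: e' = (z, fr z - z).
  by apply: vecL_eq; rewrite !vE /=; ring.
have vC (w s : K) : w *: h + s *: p = ((w + s * (t * th)) / g, s).
  by apply: vecL_eq; rewrite !vE /=; [field | ring].
have cs (y : K) : y \in plane_section g t <->
    @tr F K (g * y) = t /\ exists2 x : K, fr x != x & y = x / (fr x - x).
  rewrite inE; split=> [/andP[/eqP ty /existsP [z /andP[nz /eqP ez]]]|[ty [z nz ez]]].
    by split=> //; exists z.
  by apply/andP; split; [apply/eqP | apply/existsP; exists z; rewrite nz; apply/eqP].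
have ft' : @fr F K t = t := ft.
suff -> : S :&: C = H |: affpt @: plane_section g t.
  rewrite cardsU1 (card_imset _ affpt_inj).
  suff -> : H \notin affpt @: plane_section g t by rewrite add1n.
  apply/imsetP => -[y _ eH]; have := memH (aff y).
  by rewrite eH memv_line /= oner_eq0.
apply/setP => X; rewrite !inE; apply/andP/orP => [[/SP [z z0 zX]]|[/eqP ->|/imsetP [y]]].
- case/CP => [w [s [tw fs wn wX]]]; rewrite vS in zX; rewrite vC in wn wX.
  have zn : ((z, fr z - z) : vL) != 0 by rewrite pair_neq0 z0.
  have [fz|nz] := eqVneq (fr z) z.
    by left; apply/eqP/(point_eq zn zX); rewrite memH fz subrr.
  right; apply/imsetP; exists (z / (fr z - z)); last first.
    by apply: (affptE zn zX); rewrite /= divfK // subr_eq0.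
  have eX : X = affpt (z / (fr z - z)).
    by apply: (affptE zn zX); rewrite /= divfK // subr_eq0.
  move: wX; rewrite eX mem_affpt /= => /eqP ew.
  have s0 : s != 0.
    apply: contra wn => /eqP s0; move: ew; rewrite s0 mulr0 => ->; exact/eqP.
  apply/cs; split; last by exists z.
  have -> : g * (z / (fr z - z)) = s^-1 * w + t * th.
    have -> : z / (fr z - z) = (w + s * (t * th)) / g / s by rewrite ew mulfK.
    by field; rewrite g0 s0.
  have fsV : fr s^-1 = s^-1 by rewrite frV fs.
  by rewrite trD (trZ _ fsV) (trZ _ ft') tw tth mulr0 add0r mulr1.
- split; first by apply/SP; exists 1; rewrite ?oner_neq0 // vS memH /= fr1 subrr.
  have [w [w0 tw _]] := exists_trace0_inv hK (oner_neq0 K).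
  apply/CP; exists w, 0; rewrite fr0 vC memH /= eqxx; split=> //.
  by rewrite pair_neq0 mul0r addr0 mulf_neq0 ?invr_eq0.
case/cs => ty [z nz ey] ->; have nz' : fr z - z != 0 by rewrite subr_eq0.
split.
  apply/SP; exists z; first by apply: contra nz => /eqP ->; rewrite fr0.
  by rewrite vS mem_affpt /= ey divfK.
apply/CP; exists (g * y - t * th), 1; rewrite fr1 vC mem_affpt /=; split=> //.
- by rewrite trB (trZ _ ft') tth mulr1 ty subrr.
- by rewrite pair_neq0 oner_neq0 orbT.
- by apply/eqP; field.
Qed.

(** Rescaling the parameter [x] moves a given point to the parameter [x = 1]. *)
Lemma max_scattered_param_at (S : {set pt}) (X : pt) (v : vL) :
    max_scattered S -> X \in S -> v != 0 -> v \in val X ->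
  exists e e' : vL, [/\ det e e' != 0, v = e + e' & scattered_param S e e'].
Proof.
move=> /(max_scattered_param_exists) [e [e' [n SP]]] /SP [x x0 xX] v0 vX.
have u0 : x *: e + fr x *: e' != 0.
  by apply: contra x0 => /eqP/(comb_eq0 n) [-> _].
have [l el] := point_scale u0 xX vX.
have l0 : l != 0 by apply: contra v0 => /eqP l0; rewrite el l0 scale0r.
have fx0 : fr x != 0 by rewrite (fr_eq0 hK).
have comb y : y *: ((l * x) *: e) + fr y *: ((l * fr x) *: e') = l *: ((x * y) *: e + fr (x * y) *: e').
  by apply: vecL_eq; rewrite !vE frM; ring.
exists ((l * x) *: e), ((l * fr x) *: e'); split.
- have -> : det ((l * x) *: e) ((l * fr x) *: e') = l * x * (l * fr x) * det e e'.
    by rewrite /det !vE; ring.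
  by rewrite !mulf_neq0.
- by rewrite el scalerDr !scalerA.
move=> Y; split=> [/SP [y y0 yY]|[y y0]].
  exists (x^-1 * y); first by rewrite mulf_neq0 ?invr_eq0.
  by rewrite comb mulVKf //; apply: memvZ.
rewrite comb => yY; apply/SP; exists (x * y); first by rewrite mulf_neq0.
by rewrite -(scalerK l0 (_ *: e + _)); apply: memvZ.
Qed.

Lemma scattered_param_norm (S : {set pt}) (e e' : vL) (a b : K) (Y : pt) :
  scattered_param S e e' -> a != 0 -> nm a = nm b -> a *: e + b *: e' \in val Y -> Y \in S.
Proof.
move=> SP a0 nab abY; have [y y0 ey] := nm_eq_ratio hK a0 (esym nab).
apply/SP; exists y => //.
have -> : y *: e + fr y *: e' = (y / a) *: (a *: e + b *: e').
  have -> : fr y = b * y / a by rewrite -ey mulfK.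
  by apply: vecL_eq; rewrite !vE; field.
exact: memvZ.
Qed.

(** With [p = al h + ep' e'], the points [x h + (fr x - x) e'] of [S] and
    [w h + p] of [C] agree when [w = ep' * x / u - al], where [u = fr x - x]. If
    [tr (ep' / u) <> 0], adding to [x] a suitable element of [F], which does not
    change [u], makes the trace of [w] vanish. *)
Lemma head_notin_single_meet (S C : {set pt}) (H : pt) :
  max_scattered S -> club_with_head C H -> #|S :&: C| = 1%N -> H \notin S.
Proof.
move=> mS cC cSC; apply/negP => HS.
have [h [p [n hH CP]]] := club_param_exists cC.
have h0 : h != 0 by apply: contra n => /eqP ->; rewrite /det /= !mul0r subrr.
have [e [e' [ne eh SP]]] := max_scattered_param_at mS HS h0 hH.
have nhe : det h e' != 0 by have -> : det h e' = det e e' by rewrite eh /det !vE; ring.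
have ep := cramer p nhe.
set al := _ / _ in ep; set ep' := (X in _ + X *: e') in ep.
have ep0 : ep' != 0 by rewrite /ep' mulf_neq0 ?invr_eq0.
have [u [u0 tu teu]] := exists_trace0_inv hK ep0.
have [x ex] := additive_hilbert90 hK tu.
pose s := (tr al - tr (ep' * x / u)) / tr (ep' / u).
have fs : fr s = s by rewrite /s frM frV frD frN !(fr_tr hK).
pose w := ep' * (x + s) / u - al.
have tw : tr w = 0.
  have -> : w = ep' * x / u + s * (ep' / u) - al by rewrite /w; field.
  by rewrite trB trD (trZ _ fs) /s divfK // [X in X - _]addrC subrK subrr.
have y0 : x + s != 0.
  apply: contra u0; rewrite addr_eq0 => /eqP xs.
  by rewrite -ex xs frN fs subrr.
have ev : w *: h + 1 *: p = (ep' / u) *: ((x + s) *: e + fr (x + s) *: e').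
  have fx : fr (x + s) = x + u + s by rewrite frD fs -ex; ring.
  rewrite fx ep eh /w; apply: vecL_eq; rewrite !vE; field; exact: u0.
have dv : det h (w *: h + 1 *: p) != 0.
  by rewrite det_comb_l mul1r.
have v0 : w *: h + 1 *: p != 0.
  by apply: contra dv => /eqP ->; rewrite /det /= !mulr0 subrr.
have [Q vQ] := exists_point v0.
have QC : Q \in C by apply/CP; exists w, 1; rewrite fr1.
have QS : Q \in S.
  apply/SP; exists (x + s) => //.
  have k0 : ep' / u != 0 by rewrite mulf_neq0 ?invr_eq0.
  by rewrite -(scalerK k0 (_ *: e + _)) -ev; apply: memvZ.
have HC : H \in C.
  have [z [z0 tz _]] := exists_trace0_inv hK (oner_neq0 K).
  apply/CP; exists z, 0; rewrite fr0 scale0r addr0 memvZ // scaler_eq0 negb_or z0; split=> //.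
have /eqP/cards1P [P eP] := cSC.
have : Q \in [set P] by rewrite -eP inE QS QC.
have : H \in [set P] by rewrite -eP inE HS HC.
rewrite !inE => /eqP eH /eqP eQ.
by move: dv; rewrite -(point_det _ h0 hH) eH -eQ vQ.
Qed.

(** The common point is not the head, so it may replace the second basis vector of
    the club, and [even_second_solution] produces another common point. *)
Lemma single_meet_odd (S C : {set pt}) :
  max_scattered S -> club C -> #|S :&: C| = 1%N -> odd q.
Proof.
move=> mS [H cC] cSC; apply: contraT => ev.
have HS := head_notin_single_meet mS cC cSC.
have [h [p [n hH CP]]] := club_param_exists cC.
have h0 : h != 0 by apply: contra n => /eqP ->; rewrite /det /= !mul0r subrr.
have /eqP/cards1P [P eP] := cSC.
have : P \in S :&: C by rewrite eP inE.
rewrite inE => /andP[PS /CP [w0 [t0 [tw0 ft0 v0 vP]]]].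
set v := (_ + _) in v0 vP.
have dhv : det h v = t0 * det h p by rewrite det_comb_l.
have t00 : t0 != 0.
  apply: contra HS => /eqP t00; suff -> : H = P by [].
  apply: (point_eq v0) => //; rewrite (point_det _ h0 hH) dhv t00 mul0r eqxx //.
have dhv0 : det h v != 0 by rewrite dhv mulf_neq0.
have [e [e' [ne ev0 SP]]] := max_scattered_param_at mS PS v0 vP.
have eh := cramer h ne.
set a := _ / _ in eh; set c := (X in _ + X *: e') in eh.
have dhac : det h v = (a - c) * det e e'.
  by rewrite eh ev0 /det !vE; ring.
have ac : a != c.
  by apply: contra dhv0 => /eqP ac; rewrite dhac ac subrr mul0r.
have nac : nm a != nm c.
  apply: contra HS => /eqP nac; apply: (scattered_param_norm SP _ nac); last by rewrite -eh.
  apply: contra ac => /eqP a0; apply/eqP; rewrite a0; apply/esym/eqP.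
  by rewrite -(nm_eq0 hK) -nac a0 /nm mul0r mul0r.
have [w [wn tw nw]] := even_second_solution hK ev ac nac.
have e1 : v + w *: h = (1 + a * w) *: e + (1 + c * w) *: e'.
  by rewrite [in w *: h]eh ev0; apply: vecL_eq; rewrite !vE; ring.
have e2 : v + w *: h = (w0 + w) *: h + t0 *: p.
  by rewrite /v; apply: vecL_eq; rewrite !vE; ring.
have dv1 : det v (v + w *: h) != 0.
  have -> : det v (v + w *: h) = - (w * det h v) by rewrite /det !vE; ring.
  by rewrite oppr_eq0 mulf_neq0.
have v10 : v + w *: h != 0.
  by apply: contra dv1 => /eqP ->; rewrite /det /= !mulr0 subrr.
have [Q vQ] := exists_point v10.
have QC : Q \in C.
  by apply/CP; exists (w0 + w), t0; rewrite -e2 trD tw0 tw addr0.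
have QS : Q \in S.
  apply: (scattered_param_norm SP _ nw); last by rewrite -e1.
  apply: contra ac => /eqP aw0; apply/eqP; apply: (mulIf wn); apply: (addrI 1).
  rewrite aw0; apply/esym/eqP; rewrite -(nm_eq0 hK) -nw aw0 /nm mul0r mul0r //.
have : Q \in [set P] by rewrite -eP inE QS QC.
rewrite inE => /eqP eQ; move: dv1.
by rewrite -(point_det _ v0 vP) -eQ vQ.
Qed.

(** If [y = (x - fr x) / (x + fr x)], then [1 + y] and [1 - y] are the products of
    [2 / (x + fr x)] by the conjugate elements [x] and [fr x], so they have the same
    norm. *)
Lemma exists_single_meet : odd q -> exists S C : {set pt},
  [/\ max_scattered S, club C & #|S :&: C| = 1%N].
Proof.
move=> oq; have n2 : 2%:R != 0 :> K by exact: char_neq2_of_odd oq.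
pose e : vL := (1, 1); pose e' : vL := (-1, 1).
have ne : det e e' != 0 by rewrite /det /= (_ : _ - _ = 2%:R) //; ring.
have [S [msS SP]] := exists_max_scattered ne.
pose h : vL := (1, 0); pose p : vL := (0, 1).
have nh : det h p != 0 by rewrite /det /= mulr1 mul0r subr0 oner_neq0.
have h0 : h != 0 by rewrite pair_neq0 oner_neq0.
have [H hH] := exists_point h0.
have [C [clC CP]] := exists_club nh hH.
exists S, C; split=> //; first by exists H.
have vS (z : K) : z *: e + fr z *: e' = (z - fr z, z + fr z).
  by apply: vecL_eq; rewrite !vE /=; ring.
have vC (w s : K) : w *: h + s *: p = (w, s).
  by apply: vecL_eq; rewrite !vE /=; ring.
suff -> : S :&: C = [set affpt 0] by rewrite cards1.
apply/setP => X; rewrite !inE; apply/andP/eqP => [[/SP [z z0 zX] /CP]|->].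
  case=> [w [t [tw ft wn wX]]]; rewrite vS in zX; rewrite vC in wn wX.
  have zp : z + fr z != 0.
    apply: contra z0 => /eqP zz.
    have e1 : fr z = - z by apply/eqP; rewrite -addr_eq0 addrC zz.
    have e3 : z = - z by rewrite -{1}(fr3 hK z) !e1 frN e1 opprK.
    have : 2%:R * z = 0 by rewrite -(subrr z) [in X in _ - X]e3; ring.
    by move/eqP; rewrite mulf_eq0 (negbTE n2).
  have zn : ((z - fr z, z + fr z) : vL) != 0 by rewrite pair_neq0 zp orbT.
  pose y := (z - fr z) / (z + fr z).
  have eX : X = affpt y by apply: (affptE zn zX); rewrite /= divfK.
  have ew : w = y * t by move: wX; rewrite eX mem_affpt /= => /eqP.
  have t0 : t != 0.
    by apply: contra wn => /eqP t0; rewrite ew t0 mulr0.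
  have ty : tr y = 0.
    by move/eqP: tw; rewrite ew mulrC (trZ _ ft) mulf_eq0 (negbTE t0) => /eqP.
  rewrite eX (nm_1D_eq_trace0 hK n2 ty) //.
  have -> : 1 + y = 2%:R * z / (z + fr z) by rewrite /y; field.
  have -> : 1 - y = 2%:R * fr z / (z + fr z) by rewrite /y; field.
  rewrite !nmM; congr (_ * _ * _).
  by rewrite /nm (fr3 hK); ring.
split.
  by apply/SP; exists 1; rewrite ?oner_neq0 // vS mem_affpt /= fr1 subrr mul0r.
apply/CP; exists 0, 1; rewrite vC mem_affpt /= mul0r fr1 /tr !fr0 !addr0; split=> //.
by rewrite pair_neq0 oner_neq0 orbT.
Qed.

End Geometry.

Theorem corollary11 (q : nat) (F : finFieldType) (L : fieldExtType F)
    (hF : #|F| = q) (hL : \dim {:L} = 3) :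
  (forall x : nat,
     x \in [:: q; q + 1; q + 2; 2 * q; 2 * q + 1] ->
     ~ (q = 2 /\ x = 2) ->
     exists S C : {set point L},
       [/\ max_scattered S, club C & #|S :&: C| = x])
  /\
  ((exists S C : {set point L},
      [/\ max_scattered S, club C & #|S :&: C| = 1]) <-> odd q)
  /\
  (forall (S C : {set point L}) (H P : point L),
     max_scattered S -> club_with_head C H ->
     #|S :&: C| = 1 -> P \in S :&: C -> P <> H).
Proof.
rewrite -hF; split; first exact: exists_meet_card.
split; first split.
- by case=> S [C [mS cC cSC]]; apply: (single_meet_odd hL mS cC cSC).
- exact: exists_single_meet.
move=> S C H P mS cC cSC; rewrite inE => /andP[PS _] eP.
by move: (head_notin_single_meet hL mS cC cSC); rewrite -eP PS.
Qed.
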